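(* Let $G=(V,E)$ be a connected undirected unweighted graph with $n=|V|\ge 2$ nodes. (a) The problem ADIM$_{=1}$ admits a $(1+\ln(n-1))$-approximation in $O(n^3)$ time. (b) If $G$ has at least one node of degree $1$, then $L_{\mathrm{opt}}^{=1}=1$, and thus ADIM$_{=1}$ can be solved in $O(n^3)$ time (on such graphs). (c) If $G$ does not contain a cycle of $4$ edges, then $L_{\mathrm{opt}}^{=1}\le 2$, and thus ADIM$_{=1}$ can be solved in $O(n^3)$ time (on such graphs).
   Context: Let $\mathrm{dist}_{u,v}$ be the number of edges in a shortest path between $u,v\in V$. For $\emptyset\subset V'\subset V$ (proper inclusions) and $v\in V\setminus V'$, let $\mathbf{d}_{v,-V'}=(\mathrm{dist}_{v,u})_{u\in V'}$ be the metric representation of $v$ with respect to $V'$. Two nodes of $V\setminus V'$ are equivalent if they have the same metric representation with respect to $V'$; $\mu(\mathcal{D}_{V\setminus V',-V'})$ is the minimum cardinality of an equivalence class of $V\setminus V'$. Problem ADIM$_{=1}$: given $G$, find a set $V'$ with $\emptyset\subset V'\subset V$ of minimum cardinality such that $\mu(\mathcal{D}_{V\setminus V',-V'})=1$. The minimum cardinality is denoted $L_{\mathrm{opt}}^{=1}$. ''Contains a cycle of $4$ edges'' means that $G$ has a (not necessarily induced) subgraph that is a cycle on $4$ nodes. A $\rho$-approximation is a polynomial-time algorithm producing a feasible solution of cardinality at most $\rho$ times the optimum. Running times are in the standard unit-cost RAM model. *)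

(* Defs.v *)
From HB Require Import structures.
From mathcomp Require Import all_boot.

Set Implicit Arguments.
Unset Strict Implicit.
Unset Printing Implicit Defensive.

Section Graph.

Variables (T : finType) (e : rel T).

Definition simple_graph : Prop := symmetric e /\ irreflexive e.

Definition connected_graph : Prop := forall u v : T, connect e u v.

Definition degree (v : T) : nat := #|[set u | e v u]|.

Definition contains_C4 : Prop := exists s : 4.-tuple T, cycle e s && uniq s.

Definition has_path (k : nat) (u v : T) : bool :=
  [exists p : k.-tuple T, [&& path e u p, uniq (u :: p) & last u p == v]].

(* A simple path has fewer than #|T| edges, so the search range loses nothing;
   the value is #|T| when v is not reachable from u. *)
Definition dist (u v : T) : nat := find (fun k => has_path k u v) (iota 0 #|T|).

(* The vector of distances from v, indexed by V' in the order of enum V'. *)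
Definition metric_rep (V' : {set T}) (v : T) : seq nat :=
  [seq dist v u | u <- enum V'].

Definition metric_classes (V' : {set T}) : {set {set T}} :=
  preim_partition (metric_rep V') (~: V').

(* No class has more than #|T| elements, so the neutral value #|T| does not
   affect the minimum as long as there is a class, that is, V' is proper. *)
Definition mu (V' : {set T}) : nat :=
  \big[minn/#|T|]_(C in metric_classes V') #|C|.

Definition feasible (V' : {set T}) : bool :=
  [&& set0 \proper V', V' \proper [set: T] & mu V' == 1].

(* Feasible sets have fewer than #|T| elements, so the neutral value #|T| is
   returned only if there is no feasible set. *)
Definition Lopt : nat :=
  \big[minn/#|T|]_(V' : {set T} | feasible V') #|V'|.

End Graph.

(* Unit-cost random access machine over the natural numbers. A program mentions
   finitely many registers, and memory is accessed by indirect addressing only.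
   Arithmetic is limited to addition and truncated subtraction: unit-cost
   multiplication would let numbers grow too fast for the model to be
   polynomially related to Turing machines. *)
Inductive instr : Type :=
| Const of nat & nat
| Add of nat & nat & nat
| Sub of nat & nat & nat
| Fetch of nat & nat
| Store of nat & nat
| Jump of nat
| Jzero of nat & nat.

Definition program : Type := seq instr.

Record config : Type := Config {
  pc : nat;
  reg : nat -> nat;
  memory : nat -> nat
}.

Definition exec (i : instr) (s : config) : config :=
  let: Config p r m := s in
  match i with
  | Const a k => Config p.+1 [eta r with a |-> k] m
  | Add a b c => Config p.+1 [eta r with a |-> r b + r c] m
  | Sub a b c => Config p.+1 [eta r with a |-> r b - r c] m
  | Fetch a b => Config p.+1 [eta r with a |-> m (r b)] m
  | Store a b => Config p.+1 r [eta m with r a |-> r b]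
  | Jump l => Config l r m
  | Jzero a l => Config (if r a == 0 then l else p.+1) r m
  end.

Definition halted (P : program) (s : config) : bool := size P <= pc s.

Definition step (P : program) (s : config) : config :=
  if halted P s then s else exec (nth (Jump 0) P (pc s)) s.

Section InputOutput.

Variables (T : finType) (e : rel T).

(* Cell 0 holds the number n of nodes, the next n ^ 2 cells the adjacency matrix
   in row-major order; all other cells and all registers are 0. *)
Definition input : config :=
  Config 0 (fun=> 0)
    (nth 0 (#|T| :: [seq nat_of_bool (e u v) | u <- enum T, v <- enum T])).

(* The first n cells hold the (nonzero) membership flags of the nodes. *)
Definition output (s : config) : {set T} := [set v | memory s (enum_rank v) != 0].

(* Each step costs 1, and a halted configuration is a fixed point of step. *)
Definition computes_within (P : program) (t : nat) (S : {set T}) : Prop :=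
  let s := iter t (step P) input in halted P s /\ output s = S.

End InputOutput.

(* Main.v *)
(* Choosing which node [v] is to be alone in its class turns the problem into set
   cover: a node [w] covers the nodes [u] with dist w u != dist w v. For the
   right [v] the greedy algorithm selects at most Lopt * H(n - 1) nodes, where H
   is the harmonic sum, and exactly one node if one suffices, which is the case
   when some [w] is a leaf, since its neighbour is the only node at distance 1
   from [w]. Without 4-cycles, two neighbours of a node [v] always single out
   [v].

   The greedy algorithm keeps, for each [w], the number of nodes that [w] would
   newly cover. In each of its n rounds the machine covers a single node, after
   selecting a new [w] if the last one covers nothing more, so that a round costs
   O(n). Distances come from the Floyd-Warshall algorithm. The machine code is
   compiled from a small language in which every loop runs n times, so that a
   program with loops nested k deep takes O(n^k) steps. *)
Require Import Defs.
From mathcomp Require Import all_boot all_order all_algebra.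
From mathcomp Require Import reals exp.
From mathcomp Require Import zify.

Import Order.TTheory GRing.Theory Num.Theory.
(* mathcomp also has a [Sub], which would hide the machine instruction. *)
Import Defs.

Set Implicit Arguments.
Unset Strict Implicit.
Unset Printing Implicit Defensive.

(** * A structured language and its compiler *)

(** With one greedy run for each [v], the cubic budget leaves O(n^2) steps for a run. Recomputing
    every gain after each selection could cost O(n^2) per selection; here the gains are updated
    point by point, and a run has only n - 1 points to separate.

    The relation [greedy] leaves ties open. The analysis of the selections is thus independent of
    the machine, whose runs only have to be instances of the relation.

    The argument of the harmonic sum is n - 1 because [v] itself need not be separated, and the
    ratio in (a) follows from H(m) <= 1 + ln m.

    In (c) nothing has to be tested on the graph. A best greedy selection of more than one node
    certifies that the optimum is not 1; then no node is a leaf, so any fixed node has two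
    neighbours, and they form an optimal set. *)

Definition store : Type := (nat -> nat) * (nat -> nat).

Definition upd (f : nat -> nat) (a k : nat) : nat -> nat := [eta f with a |-> k].
Arguments upd f a k x /.

Definition effect (i : instr) (s : store) : store :=
  let: (r, m) := s in
  match i with
  | Const a k => (upd r a (k), m)
  | Add a b c => (upd r a (r b + r c), m)
  | Sub a b c => (upd r a (r b - r c), m)
  | Fetch a b => (upd r a (m (r b)), m)
  | Store a b => (r, upd m (r a) (r b))
  | Jump _ | Jzero _ _ => s
  end.

Definition effects (l : seq instr) (s : store) : store :=
  foldl (fun s i => effect i s) s l.
Arguments effects : simpl never.

(* In [For i p c] the body [c] runs for [i = 0, ..., n - 1], where [n] is the
   content of register 0, with [p = i * n + 1], the address of row [i] of the
   input matrix. Register 1 is scratch. *)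
Inductive cmd : Type :=
| Block of seq instr
| Seq of cmd & cmd
| When of nat & cmd
| For of nat & nat & cmd.

Definition for_init i p := [:: Const i 0; Const p 1].
Definition for_test i := [:: Sub 1 0 i].
Definition for_next i p := [:: Const 1 1; Add i i 1; Add p p 0].

(** The [for_test] after the iteration is the failing test that ends the loop. It too overwrites
    register 1, so that [run] agrees with the machine on all registers. *)
Fixpoint run (c : cmd) (s : store) : store :=
  match c with
  | Block l => effects l s
  | Seq c1 c2 => run c2 (run c1 s)
  | When a c => if s.1 a == 0 then s else run c s
  | For i p c =>
      effects (for_test i)
        (iter (s.1 0)
           (fun s => effects (for_next i p) (run c (effects (for_test i) s)))
           (effects (for_init i p) s))
  end.

(** Jump targets are absolute, hence the argument [o], the address of the first instruction. A loop
    has its test at [o + 2], its body at [o + 4] and its exit at [o + 8 + size l]. *)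
Fixpoint compile (c : cmd) (o : nat) : seq instr :=
  match c with
  | Block l => l
  | Seq c1 c2 =>
      let l1 := compile c1 o in l1 ++ compile c2 (o + size l1)
  | When a c =>
      let l := compile c (o + 1) in Jzero a (o + 1 + size l) :: l
  | For i p c =>
      let l := compile c (o + 4) in
      for_init i p ++ for_test i ++ Jzero 1 (o + 8 + size l) ::
      l ++ for_next i p ++ [:: Jump (o + 2)]
  end.

Definition target (i : instr) : seq nat :=
  match i with
  | Const a _ | Add a _ _ | Sub a _ _ | Fetch a _ => [:: a]
  | _ => [::]
  end.

Definition straight (i : instr) : bool :=
  match i with Jump _ | Jzero _ _ => false | _ => true end.

Fixpoint writes (c : cmd) : seq nat :=
  match c with
  | Block l => flatten (map target l)
  | Seq c1 c2 => writes c1 ++ writes c2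
  | When _ c => writes c
  | For i p c => [:: 1, i, p & writes c]
  end.

(** Register 0 is never written, so all loops share the bound n, and no body touches the counters of
    its loop, so each loop makes exactly n iterations. *)
Fixpoint wf (c : cmd) : bool :=
  match c with
  | Block l => all straight l && (0 \notin writes (Block l))
  | Seq c1 c2 => wf c1 && wf c2
  | When _ c => wf c
  | For i p c =>
      [&& wf c, uniq [:: 0; 1; i; p], i \notin writes c & p \notin writes c]
  end.

(** For a loop, 4 is the initialization (2) and the failing test with its jump (2); 6 is the test
    with its jump (2), the increments (3) and the jump back (1). *)
Fixpoint cost (c : cmd) (n : nat) : nat :=
  match c with
  | Block l => size l
  | Seq c1 c2 => cost c1 n + cost c2 n
  | When _ c => 1 + cost c n
  | For _ _ c => 4 + n * (6 + cost c n)
  end.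

Fixpoint depth (c : cmd) : nat :=
  match c with
  | Block _ => 0
  | Seq c1 c2 => maxn (depth c1) (depth c2)
  | When _ c => depth c
  | For _ _ c => (depth c).+1
  end.

(** The cost is a polynomial in n of degree at most [depth c], and its value at 1 is the sum of its
    coefficients. *)
Lemma cost_poly c n : 0 < n -> cost c n <= cost c 1 * n ^ depth c.
Proof.
move=> n_gt0; elim: c => [l|c1 IH1 c2 IH2|a c IH|i p c IH] /=.
- by rewrite muln1.
- rewrite mulnDl leq_add //.
    by apply: leq_trans IH1 _; rewrite leq_mul2l leq_pexp2l ?leq_maxl ?orbT.
  by apply: leq_trans IH2 _; rewrite leq_mul2l leq_pexp2l ?leq_maxr ?orbT.
- rewrite mulnDl leq_add // mul1n expn_gt0 n_gt0 //.
- rewrite mul1n mulnDl leq_add ?leq_pmulr ?expn_gt0 ?n_gt0 //.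
  rewrite expnS mulnCA leq_mul2l mulnDl leq_add ?orbT //.
  by rewrite leq_pmulr ?expn_gt0 ?n_gt0.
Qed.

Lemma effects_frame l s x :
  x \notin flatten (map target l) -> (effects l s).1 x = s.1 x.
Proof.
elim: l s => [//|i l IH] s /=; rewrite mem_cat negb_or => /andP[xi xl].
rewrite /effects /= -/(effects l _) IH //; case: s => r m.
by case: i xi => [a k|a b d|a b d|a b|a b|a|a b] //=;
  rewrite inE => /negbTE->.
Qed.

Lemma run_frame c s x : x \notin writes c -> (run c s).1 x = s.1 x.
Proof.
elim: c s => [l|c1 IH1 c2 IH2|a c IH|i p c IH] s.
- exact: effects_frame.
- by rewrite /= mem_cat negb_or => /andP[x1 x2]; rewrite IH2 // IH1.
- by move=> /= xc; case: eqP => // _; rewrite IH.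
- move=> /=; rewrite !inE !negb_or => /and4P[x1 xi xp xc].
  rewrite effects_frame /= ?inE ?x1 //.
  suff iterE k s' : (iter k (fun s => effects (for_next i p)
      (run c (effects (for_test i) s))) s').1 x = s'.1 x.
    by rewrite iterE effects_frame //= !inE negb_or xi.
  elim: k => //= k IHk.
  rewrite effects_frame ?inE ?negb_or ?x1 ?xi ?xp // IH //.
  by rewrite effects_frame ?inE.
Qed.

Lemma wf_zero c : wf c -> 0 \notin writes c.
Proof.
elim: c => [l /andP[]//|c1 IH1 c2 IH2 /andP[w1 w2]|a c IH|i p c IH].
- by rewrite /= mem_cat negb_or IH1 ?IH2.
- by [].
- rewrite /= !inE !negb_or => /and4P[/IH-> /andP[/and3P[_ -> ->]]].
  by [].
Qed.

Lemma run_zero c s : wf c -> (run c s).1 0 = s.1 0.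
Proof. by move=> /wf_zero; exact: run_frame. Qed.

(** * Correctness and running time of compiled code *)

Definition conf (p : nat) (s : store) : config := Config p s.1 s.2.

Lemma step_conf P pre i post s :
  P = pre ++ i :: post -> step P (conf (size pre) s) = exec i (conf (size pre) s).
Proof.
move=> ->; rewrite /step /halted /= size_cat /=.
by rewrite leqNgt -addSnnS leq_addr /= nth_cat ltnn subnn.
Qed.

Lemma exec_straight i p s :
  straight i -> exec i (conf p s) = conf p.+1 (effect i s).
Proof. by case: s => r m; case: i. Qed.

Lemma effects_correct l P pre post s : all straight l ->
  P = pre ++ l ++ post ->
  iter (size l) (step P) (conf (size pre) s)
    = conf (size pre + size l) (effects l s).
Proof.
elim: l pre s => [|i l IH] pre s /=; first by rewrite addn0.
move=> /andP[si sl] defP; rewrite -iterS iterSr (step_conf _ defP).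
rewrite exec_straight // -addSnnS -(size_rcons pre i) IH //.
by rewrite defP cat_rcons.
Qed.

(** The time is only an upper bound, because [When] may skip a body that [cost] counts. *)
Definition reach P t (s s' : config) := exists2 k, k <= t & iter k (step P) s = s'.

Lemma reach_trans P t1 t2 s1 s2 s3 :
  reach P t1 s1 s2 -> reach P t2 s2 s3 -> reach P (t1 + t2) s1 s3.
Proof.
move=> [k1 k1t <-] [k2 k2t <-]; exists (k2 + k1); last by rewrite iterD.
by rewrite addnC leq_add.
Qed.

Lemma reach_step P pre i post s s' :
  P = pre ++ i :: post -> exec i (conf (size pre) s) = s' ->
  reach P 1 (conf (size pre) s) s'.
Proof. by move=> defP <-; exists 1; rewrite //= (step_conf _ defP). Qed.

Lemma reach_effects l P pre post s : all straight l -> P = pre ++ l ++ post ->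
  reach P (size l) (conf (size pre) s) (conf (size pre + size l) (effects l s)).
Proof. by move=> sl defP; exists (size l); rewrite ?(effects_correct _ _ defP). Qed.

(** The machine cannot multiply; the row address arises by adding n once per iteration. *)
Lemma for_iter i p c s k : wf (For i p c) ->
  let s' := iter k (fun s => effects (for_next i p)
              (run c (effects (for_test i) s))) (effects (for_init i p) s) in
  [/\ s'.1 0 = s.1 0, s'.1 i = k & s'.1 p = k * s.1 0 + 1].
Proof.
move=> /= /and4P[wc /and3P[]]; rewrite !inE !negb_or !andbT.
move=> /and3P[_ i0 p0] /andP[i1 p1] ip ic pc.
have [zi zp] : (0 == i) = false /\ (0 == p) = false.
  by split; apply/negbTE.
have [ipF piF] : (i == p) = false /\ (p == i) = false.
  by rewrite eq_sym; split; apply/negbTE; rewrite // eq_sym.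
have [oi op] : (i == 1) = false /\ (p == 1) = false.
  by rewrite ![_ == 1]eq_sym; split; apply/negbTE.
elim: k => [|k [IH0 IHi IHp]].
  by case: s => r m; rewrite /= !eqxx ipF zi zp.
rewrite iterS; move: (iter k _ _) IH0 IHi IHp => s' IH0 IHi IHp.
have E x : x \notin writes c -> x != 1 ->
    (run c (effects (for_test i) s')).1 x = s'.1 x.
  by move=> xc x1; rewrite run_frame ?effects_frame ?inE.
have := E 0 (wf_zero wc) isT; have := E i ic (negbT oi).
have := E p pc (negbT op); case: (run c _) => r m /= -> -> ->.
by rewrite !eqxx oi op zi zp ipF piF IH0 IHi IHp addn1 mulSnr addnAC; split.
Qed.

Lemma compile_correct c P pre post s : wf c ->
  P = pre ++ compile c (size pre) ++ post ->
  reach P (cost c (s.1 0)) (conf (size pre) s)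
    (conf (size pre + size (compile c (size pre))) (run c s)).
Proof.
elim: c pre post s => [l|c1 IH1 c2 IH2|a c IH|i p c IH] pre post s.
- by move=> /andP[sl _] defP; exact: reach_effects defP.
- move=> /= /andP[w1 w2]; set l1 := compile c1 _; rewrite -size_cat -catA => defP.
  apply: reach_trans (IH1 _ _ _ w1 defP) _.
  rewrite -(run_zero s w1) size_cat addnA -size_cat.
  by apply: (IH2 _ post); rewrite // -catA.
- move=> /= wc; set l := compile c _ => defP.
  have [sa|sa] := ifPn.
    exists 1; rewrite //= (step_conf _ defP) /= sa.
    by rewrite /conf addn1 addSnnS.
  apply: (@reach_trans _ 1 _ _ (conf (size pre).+1 s)).
    by apply: (reach_step defP); rewrite /= (negbTE sa).
  have /(IH (rcons pre (Jzero a (size pre + 1 + size l))) post s wc) :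
      P = rcons pre (Jzero a (size pre + 1 + size l)) ++
          compile c (size (rcons pre (Jzero a (size pre + 1 + size l)))) ++ post.
    by rewrite cat_rcons size_rcons -(addn1 (size pre)).
  by rewrite !size_rcons -(addn1 (size pre)) -/l -addnA.
- move=> wF; have /= := wF => /and4P[wc _ _ _]; set l := compile c _ => defP.
  pose body s := effects (for_next i p) (run c (effects (for_test i) s)).
  pose J := Jzero 1 (size pre + 8 + size l).
  (* The prefixes [h0] to [h3] of the code end where the test, the conditional jump, the body and
     the increments begin. *)
  pose h0 := pre ++ for_init i p.
  pose h1 := h0 ++ for_test i.
  pose h2 := rcons h1 J.
  pose h3 := h2 ++ l.
  have P0 : P = h0 ++ for_test i ++ J :: l ++ for_next i p ++ Jump (size pre + 2) :: post.
    by rewrite defP /h0 -!catA /= -?catA /= -?catA.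
  have P1 : P = h1 ++ J :: l ++ for_next i p ++ Jump (size pre + 2) :: post.
    by rewrite P0 /h1 -!catA.
  have P2 : P = h2 ++ l ++ for_next i p ++ Jump (size pre + 2) :: post.
    by rewrite P1 /h2 cat_rcons.
  have P3 : P = h3 ++ for_next i p ++ Jump (size pre + 2) :: post.
    by rewrite P2 /h3 -!catA.
  have P4 : P = (h3 ++ for_next i p) ++ Jump (size pre + 2) :: post.
    by rewrite P3 -!catA.
  have z0 : size h0 = size pre + 2 by rewrite size_cat.
  have z1 : size h1 = size pre + 3 by rewrite size_cat z0 -addnA.
  have z2 : size h2 = size pre + 4 by rewrite size_rcons z1 -addnS.
  have z3 : size h3 = size pre + 4 + size l by rewrite size_cat z2.
  have step1 k : k < s.1 0 ->
      let s' := iter k body (effects (for_init i p) s) in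
      reach P (6 + cost c (s.1 0)) (conf (size h0) s') (conf (size h0) (body s')).
    move=> lt_k /=; have [] := for_iter s k wF; rewrite -/body.
    set s' := iter k _ _ => e0 ei _.
    pose s1 := effects (for_test i) s'.
    have s1_0 : s1.1 0 = s.1 0 by rewrite /s1 effects_frame.
    have s1_1 : s1.1 1 = s.1 0 - k by rewrite /s1; case: (s') e0 ei => r m /= -> ->.
    have -> : 6 + cost c (s.1 0) = 1 + (1 + cost c (s.1 0)) + (3 + 1) by lia.
    apply: (@reach_trans _ _ _ _ (conf (size h3) (run c s1))).
      apply: reach_trans (reach_effects s' _ P0) _ => //.
      apply: (@reach_trans _ 1 _ _ (conf (size h2) s1)).
        rewrite -size_cat; apply: (reach_step P1).
        rewrite /= -/s1 s1_1 z2 z1 subn_eq0 leqNgt lt_k /=.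
        by rewrite -addnS.
      have := IH h2 _ s1 wc _; rewrite z2 -/l s1_0 z3 => IHc.
      exact: (IHc _ P2).
    apply: (@reach_trans _ 3 1); first exact: (reach_effects _ _ P3).
    rewrite -size_cat; apply: (reach_step P4).
    by rewrite z0.
  have loop k : k <= s.1 0 ->
      reach P (k * (6 + cost c (s.1 0))) (conf (size h0) (effects (for_init i p) s))
        (conf (size h0) (iter k body (effects (for_init i p) s))).
    elim: k => [_|k IHk lt_k]; first by exists 0.
    rewrite mulSnr; apply: reach_trans (IHk (ltnW lt_k)) _.
    exact: step1.
  rewrite -[4]/(2 + 2) -addnA.
  apply: (@reach_trans _ 2 _ _ (conf (size h0) (effects (for_init i p) s))).
    rewrite size_cat; apply: (@reach_effects (for_init i p) _ _ _ _ _ _) => //.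
    exact: defP.
  rewrite addnC; apply: reach_trans (loop _ (leqnn _)) _.
  have [] := for_iter s (s.1 0) wF; rewrite -/body.
  set s' := iter _ _ _ => e0 ei _.
  have s1_1 : (effects (for_test i) s').1 1 = 0.
    by case: (s') e0 ei => r m /= -> ->; rewrite subnn.
  apply: (@reach_trans _ 1 1); first exact: (reach_effects _ _ P0).
  rewrite -size_cat; apply: (reach_step P1).
  rewrite /= -[effects (for_test i) s']/(effects (for_test i) s') s1_1 /=.
  rewrite /conf !size_cat /=; congr Config; lia.
Qed.

(** The Hoare rule for loops. The loop control runs between two executions of the body, so the
    invariant must not depend on registers 1, [i] and [p]. All registers that the loop does not
    write are known to be unchanged in the body, so that invariants need not mention them. The final
    value of [p] is the first address behind the matrix, obtained without multiplication. *)
Lemma forP (I : nat -> store -> Prop) i p c s : wf (For i p c) ->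
    (forall k r r' m, (forall x, x \notin [:: 1; i; p] -> r' x = r x) ->
       I k (r, m) -> I k (r', m)) ->
    I 0 s ->
    (forall k s', k < s.1 0 ->
       (forall x, x \notin writes (For i p c) -> s'.1 x = s.1 x) ->
       s'.1 i = k -> s'.1 p = k * s.1 0 + 1 -> I k s' -> I k.+1 (run c s')) ->
  I (s.1 0) (run (For i p c) s) /\
  (run (For i p c) s).1 p = s.1 0 * s.1 0 + 1.
Proof.
move=> wF Iframe I0 Istep.
pose body s := effects (for_next i p) (run c (effects (for_test i) s)).
pose s_ k := iter k body (effects (for_init i p) s).
have II l k s' : {subset flatten (map target l) <= [:: 1; i; p]} ->
    all (fun j => if j is Store _ _ then false else true) l ->
    I k s' -> I k (effects l s').
  move=> tl Sl; have -> : effects l s' = ((effects l s').1, s'.2).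
    elim: l Sl s' {tl} => [_ []//|j l IHl /= /andP[Sj Sl] s'].
    by rewrite {1}/effects /= -/(effects l _) IHl //; case: (s') => r m; case: j Sj.
  case: s' => r m; apply: Iframe => x xl; apply: effects_frame.
  by apply: contra xl => /tl.
have ti : {subset flatten (map target (for_test i)) <= [:: 1; i; p]}.
  by move=> x; rewrite !inE => ->.
have [/andP[i0 p0] i1 ip ic pc] : [/\ (i != 0) && (p != 0), (i != 1) && (p != 1),
    i != p, i \notin writes c & p \notin writes c].
  have /= /and4P[_ /and3P[]] := wF; rewrite !inE !negb_or !andbT.
  by move=> /and3P[_ i0 p0] ip1 ip ic pc; rewrite ![_ == 0]eq_sym i0 ![_ == 1]eq_sym.
have loop k : k <= s.1 0 ->
    I k (s_ k) /\ forall x, x \notin writes (For i p c) -> (s_ k).1 x = s.1 x.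
  elim: k => [_|k IH lt_k].
    split; first by apply: II => // x; rewrite !inE => /orP[]->; rewrite ?orbT.
    move=> x; rewrite !inE !negb_or => /and4P[_ xi xp _].
    by rewrite effects_frame //= !inE negb_or xi.
  have [Ik Fk] := IH (ltnW lt_k); have [e0 ei ep] := for_iter s k wF.
  rewrite -/body -/(s_ k) in e0 ei ep.
  split=> [|x xW].
    rewrite /s_ iterS -/(s_ k); apply: (II) => //; apply: Istep => //; last exact: II.
    - move=> x xW; rewrite effects_frame ?Fk //= inE.
      by move: xW; rewrite inE negb_or => /andP[].
    - by rewrite effects_frame //= inE; case/andP: i1.
    - by rewrite effects_frame //= inE; case/andP: i1.
  rewrite /s_ iterS -/(s_ k) -(Fk x xW).
  move: xW; rewrite /= !inE !negb_or => /and4P[x1 xi xp xc].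
  rewrite /body effects_frame ?inE ?negb_or ?x1 ?xi ?xp // run_frame //.
  by rewrite effects_frame ?inE.
have [Ik _] := loop _ (leqnn _); have [_ _ ep] := for_iter s (s.1 0) wF.
split; first by apply: II.
by rewrite /= effects_frame //= inE; case/andP: i1.
Qed.

Lemma forP_mem (I : nat -> (nat -> nat) -> Prop) i p c s : wf (For i p c) ->
    I 0 s.2 ->
    (forall k s', k < s.1 0 ->
       (forall x, x \notin writes (For i p c) -> s'.1 x = s.1 x) ->
       s'.1 i = k -> s'.1 p = k * s.1 0 + 1 -> I k s'.2 -> I k.+1 (run c s').2) ->
  I (s.1 0) (run (For i p c) s).2.
Proof.
by move=> wF I0 Istep; have [] := @forP (fun k s => I k s.2) i p c s wF _ I0 Istep.
Qed.

Lemma iter_step_halted P s k : halted P s -> iter k (step P) s = s.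
Proof. by move=> Ps; elim: k => //= k ->; rewrite /step Ps. Qed.

(** Register 2 is initially 0, so [Fetch 0 2] loads cell 0, that is n, into register 0, where the
    loops expect their bound. This one step accounts for the successor of [cost c 1] in the
    constant; a halted machine idles through the rest of the time bound. *)
Lemma compile_computes c : wf c -> exists k, forall (T : finType) (e : rel T),
  0 < #|T| ->
  computes_within e (Fetch 0 2 :: compile c 1) (k * #|T| ^ depth c)
    [set v : T | (run c (upd (fun=> 0) 0 #|T|, memory (input e))).2
                   (enum_rank v) != 0].
Proof.
move=> wc; exists (cost c 1).+1 => T e T_gt0.
set P := _ :: _; set s := (_, _).
have [] := @compile_correct c P [:: Fetch 0 2] [::] s wc; rewrite ?cats0 //=.
move=> k le_k; set s' := conf (_ + _) _ => def_s'.
have haltP : halted P s' by exact: leqnn.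
have le_t : k.+1 <= (cost c 1).+1 * #|T| ^ depth c.
  rewrite mulSn -add1n leq_add ?expn_gt0 ?T_gt0 //.
  exact: leq_trans le_k (cost_poly _ _).
have iter_s' : iter k.+1 (step P) (input e) = s' by rewrite iterSr -def_s'.
by rewrite /computes_within -(subnK le_t) iterD iter_s' iter_step_halted.
Qed.

Arguments run : simpl never.

Lemma run_Seq c1 c2 s : run (Seq c1 c2) s = run c2 (run c1 s).
Proof. by []. Qed.

Lemma run_When a c s : run (When a c) s = if s.1 a == 0 then s else run c s.
Proof. by []. Qed.

Lemma run_Block l s : run (Block l) s = effects l s.
Proof. by []. Qed.

(** * Distances *)

(** The number n plays the role of infinity for distinct nonadjacent nodes. The sum of both
    truncated differences of the indices vanishes exactly on the diagonal. *)
Definition init_cell :=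
  Seq (Block [:: Add 14 9 10; Fetch 15 14; Sub 15 2 15; Sub 16 8 10;
                 Sub 17 10 8; Add 16 16 17])
      (When 15 (When 16 (Block [:: Store 14 0]))).

Definition init_distances := For 8 9 (For 10 11 init_cell).

(** Register 8 holds the pivot, 10 and 12 the end points; 9 and 11 hold the row addresses of the
    pivot and of the first end point. *)
Definition relax_cell :=
  Seq (Block [:: Add 14 11 8; Fetch 14 14; Add 15 9 12; Fetch 15 15;
                 Add 14 14 15; Add 15 11 12; Fetch 16 15; Sub 16 16 14])
      (When 16 (Block [:: Store 15 14])).

Definition floyd_warshall := For 8 9 (For 10 11 (For 12 13 relax_cell)).

Definition cell (n i j : nat) : nat := i * n + 1 + j.

Lemma eq_cell n i j k l : j < n -> l < n ->
  (cell n i j == cell n k l) = (i == k) && (j == l).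
Proof.
move=> jn ln; apply/eqP/andP => [|[/eqP-> /eqP->]//]; rewrite /cell.
move=> E; suff ik : i = k by split; apply/eqP; lia.
by nia.
Qed.

Lemma run_init_distances n s : s.1 0 = n -> s.1 2 = 1 ->
  forall i j, i < n -> j < n ->
  (run init_distances s).2 (cell n i j) =
    if (s.2 (cell n i j) == 0) && (i != j) then n else s.2 (cell n i j).
Proof.
move=> rn r2; pose g i j := if (s.2 (cell n i j) == 0) && (i != j) then n
  else s.2 (cell n i j).
have := @forP_mem (fun k m => forall i j, i < n -> j < n ->
  m (cell n i j) = if i < k then g i j else s.2 (cell n i j))
  8 9 (For 10 11 init_cell) s isT.
rewrite rn => H i j lt_i lt_j; rewrite {}H ?lt_i //= => k s1 lt_k F1 ri1 rp1 I1.
have rn1 : s1.1 0 = n by rewrite F1.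
have r21 : s1.1 2 = 1 by rewrite F1.
have := @forP_mem (fun l m => forall i j, i < n -> j < n ->
  m (cell n i j) = if (i < k) || (i == k) && (j < l) then g i j else s.2 (cell n i j))
  10 11 init_cell s1 isT.
rewrite rn1 => H {i j lt_i lt_j} i j lt_i lt_j; rewrite {}H //.
  by rewrite lt_j andbT orbC -leq_eqVlt.
  by move=> i' j' lt_i' lt_j'; rewrite andbF orbF; exact: I1.
move=> l s2 lt_l F2 ri2 _ I2 {i j lt_i lt_j} i j lt_i lt_j.
have rn2 : s2.1 0 = n by rewrite F2.
have r22 : s2.1 2 = 1 by rewrite F2.
have r82 : s2.1 8 = k by rewrite F2.
have r92 : s2.1 9 = k * n + 1 by rewrite F2.
case: s2 I2 rn2 r22 r82 r92 ri2 {F2} => r m /= I2 rn2 r22 r82 r92 ri2.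
rewrite /init_cell run_Seq run_Block /effects /= !run_When /= run_Block /effects /=.
rewrite rn2 r22 r82 r92 ri2 -/(cell n k l).
have := I2 k l lt_k lt_l; rewrite ltnn eqxx ltnn /= => mkl; rewrite mkl.
have -> : (k - l + (l - k) == 0) = (k == l) by lia.
rewrite subn_eq0 lt0n ltnS [(j <= l)]leq_eqVlt andb_orr orbA orbAC.
have [/andP[/eqP-> /eqP->]|neq] := boolP ((i == k) && (j == l)).
  rewrite orbT /g; case: eqP => [E|_] /=; last by rewrite mkl.
  by case: eqP => _ /=; rewrite ?mkl ?eqxx.
rewrite orbF -I2 //; do 2?[case: ifP => _ //=].
by rewrite eq_cell // (negbTE neq).
Qed.

(** * Correctness of the Floyd-Warshall algorithm *)

Section FloydWarshall.

Variables (n : nat) (a : rel nat) (d : nat -> nat -> nat).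

Hypothesis d_triangle :
  forall i j k, i < n -> j < n -> k < n -> d i j <= d i k + d k j.
Hypothesis d_path : forall i j, i < n -> j < n -> i != j ->
  exists q, [/\ path a i (rcons q j), uniq q, all (gtn n) q & d i j = (size q).+1].

Let above (m : nat -> nat) :=
  forall i j, i < n -> j < n -> d i j <= m (cell n i j).

Let short k (m : nat -> nat) := forall i j q, i < n -> j < n ->
  path a i (rcons q j) -> uniq q -> all (gtn k) q -> m (cell n i j) <= (size q).+1.

Let relaxed k (m m' : nat -> nat) i j :=
  m' (cell n i j) <= m (cell n i k) + m (cell n k j).

(** A simple path visits [k] at most once, and there it splits into two paths with inner nodes below
    [k]. The list [q] contains inner nodes only, so its path has one edge more than [q] has
    elements. *)
Lemma short_relaxed k (m m' : nat -> nat) : k < n -> short k m ->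
  (forall b, m' b <= m b) ->
  (forall i j, i < n -> j < n -> relaxed k m m' i j) -> short k.+1 m'.
Proof.
move=> lt_k sm le_m' rm i j q lt_i lt_j path_q uniq_q all_q.
have all_k q1 : k \notin q1 -> {subset q1 <= q} -> all (gtn k) q1.
  move=> kq1 sub; apply/allP => x xq1 /=; have := allP all_q _ (sub _ xq1).
  by rewrite /= ltnS leq_eqVlt; case: eqP => // xk; rewrite -xk xq1 in kq1.
have [kq|kq] := boolP (k \in q); last first.
  by apply: leq_trans (le_m' _) _; apply: sm => //; apply: all_k.
case/splitPr: q / kq path_q uniq_q all_k {all_q} => q1 q2.
rewrite rcons_cat cat_path rcons_cons /= => /and3P[p1 pk p2].
rewrite cat_uniq /= negb_or => /and3P[u1 /andP[k1 _] /andP[k2 u2]] all_k.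
apply: leq_trans (rm _ _ lt_i lt_j) _.
rewrite size_cat /= -addSn leq_add //; apply: sm => //.
- by rewrite rcons_path p1.
- by apply: all_k => // x; rewrite mem_cat => ->.
- by apply: all_k => // x; rewrite mem_cat inE => ->; rewrite !orbT.
Qed.

Lemma run_floyd_warshall s : s.1 0 = n -> above s.2 ->
    (forall i, i < n -> s.2 (cell n i i) = 0) ->
    (forall i j, i < n -> j < n -> a i j -> s.2 (cell n i j) <= 1) ->
  forall i j, i < n -> j < n -> (run floyd_warshall s).2 (cell n i j) = d i j.
Proof.
move=> rn above_s diag_s adj_s.
have := @forP_mem (fun k m => [/\ above m, short k m
    & forall i, i < n -> m (cell n i i) = 0])
  8 9 (For 10 11 (For 12 13 relax_cell)) s isT.
rewrite rn => H.
suff [above_m short_m diag_m] : [/\ above (run floyd_warshall s).2,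
    short n (run floyd_warshall s).2
  & forall i, i < n -> (run floyd_warshall s).2 (cell n i i) = 0].
  move=> i j lt_i lt_j; apply/eqP; rewrite eqn_leq above_m // andbT.
  have [<-|neq] := eqVneq i j; first by rewrite diag_m.
  by have [q [pq uq aq ->]] := d_path lt_i lt_j neq; apply: short_m.
apply: H; first split=> // i j [|x q] lt_i lt_j //=.
  by rewrite andbT => /adj_s->.
move=> k s1 lt_k F1 ri1 rp1 [above_1 short_1 diag_1].
have rn1 : s1.1 0 = n by rewrite F1.
(* Within a round the matrix is updated in place. Cells only decrease, so it suffices to compare
   with the matrix [s1.2] at the start of the round; [D] is the set of cells dealt with so far. *)
pose J (D : rel nat) m := [/\ forall b, m b <= s1.2 b, above m
    & forall i j, i < n -> j < n -> D i j -> relaxed k s1.2 m i j].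
suff [le_m ab_m rel_m] :
    J (fun i j => i < n) (run (For 10 11 (For 12 13 relax_cell)) s1).2.
  split=> //.
    by apply: short_relaxed short_1 _ _ => // i j lt_i lt_j; apply: rel_m.
  move=> i lt_i; apply/eqP; rewrite -leqn0.
  by apply: leq_trans (le_m _) _; rewrite diag_1.
have := @forP_mem (fun l => J (fun i _ => i < l)) 10 11 (For 12 13 relax_cell) s1 isT.
rewrite rn1; apply; first by split.
move=> i s2 lt_i F2 ri2 rp2 [le_2 above_2 rel_2].
have rn2 : s2.1 0 = n by rewrite F2.
have := @forP_mem (fun l => J (fun i' j => (i' < i) || (i' == i) && (j < l)))
  12 13 relax_cell s2 isT.
rewrite rn2 => H.
have {}H : J (fun i' j => (i' < i) || (i' == i) && (j < n))
    (run (For 12 13 relax_cell) s2).2.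
  apply: H; first by split=> // i' j lt_i' lt_j; rewrite andbF orbF; apply: rel_2.
  move=> j s3 lt_j F3 ri3 _ [le_3 above_3 rel_3].
  have r8 : s3.1 8 = k by rewrite F3 // F2.
  have r9 : s3.1 9 = k * n + 1 by rewrite F3 // F2 // rp1 rn.
  have r11 : s3.1 11 = i * n + 1 by rewrite F3 // rp2 rn1.
  case: s3 le_3 above_3 rel_3 r8 r9 r11 ri3 {F3}
    => r m /= le_3 above_3 rel_3 r8 r9 r11 r12.
  rewrite /relax_cell run_Seq run_Block /effects /= !run_When /= run_Block /effects /=.
  rewrite r8 r9 r11 r12 -!/(cell n _ _) subn_eq0.
  case: leqP => /= le_m.
    split=> // i' j' lt_i' lt_j'; rewrite ltnS [j' <= j]leq_eqVlt andb_orr orbCA.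
    case/orP=> [/andP[/eqP-> /eqP->]|]; last exact: rel_3.
    by apply: leq_trans le_m _; rewrite leq_add.
  split=> [b|i' j' lt_i' lt_j'|i' j' lt_i' lt_j'].
  - rewrite /=; case: eqP => [->|_] //; exact: leq_trans (ltnW le_m) _.
  - rewrite /= eq_cell //; case: andP => [[/eqP-> /eqP->]|_]; last exact: above_3.
    by apply: leq_trans (d_triangle lt_i lt_j lt_k) _; rewrite leq_add ?above_3.
  - rewrite ltnS [j' <= j]leq_eqVlt andb_orr orbCA /relaxed /= eq_cell //.
    case: andP => [[/eqP-> /eqP->] _|_ /=]; first by rewrite leq_add.
    exact: rel_3.
case: H => le_m above_m rel_m; split=> // i' j lt_i' lt_j lt_i'1.
by apply: rel_m => //; rewrite lt_j andbT orbC -leq_eqVlt.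
Qed.

End FloydWarshall.

(** * Greedy set cover *)

Section Greedy.

Variables (T : finType) (v : T) (sep : T -> {set T}).

Hypothesis sep_self : forall w, w != v -> w \in sep w.
Hypothesis sepNv : forall w, v \notin sep w.

(* [S] is a possible selection of the greedy algorithm, and [U] the set of the
   points that it leaves inseparable from [v], including [v] itself. *)
Inductive greedy : {set T} -> {set T} -> Prop :=
| greedy_start : greedy set0 [set: T]
| greedy_select S U w :
    greedy S U -> w != v -> 0 < #|U :&: sep w| ->
    (forall w', w' != v -> #|U :&: sep w'| <= #|U :&: sep w|) ->
    greedy (w |: S) (U :\: sep w).

Definition resolves (S : {set T}) :=
  v \notin S /\ forall u, u != v -> exists2 w, w \in S & u \in sep w.

Lemma greedy_unresolved S U : greedy S U ->
  v \notin S /\ forall u, (u \in U) = [forall w in S, u \notin sep w].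
Proof.
elim=> [|{}S {}U w _ [vS US] wv _ _].
  split=> [|u]; first by rewrite inE.
  by rewrite inE; symmetry; apply/forallP => w; rewrite inE.
split=> [|u]; first by rewrite !inE negb_or eq_sym wv.
rewrite inE US; apply/andP/forall_inP => [[uw /forall_inP uS] w'|uS].
  by rewrite !inE => /predU1P[->|/uS].
split; first by rewrite uS ?setU11.
by apply/forall_inP => w' w'S; rewrite uS ?setU1r.
Qed.

Lemma greedy_mem S U : greedy S U -> v \in U.
Proof. by move=> /greedy_unresolved[_ ->]; apply/forall_inP. Qed.

Lemma greedy_fresh S U w : greedy S U -> 0 < #|U :&: sep w| -> w \notin S.
Proof.
move=> /greedy_unresolved[_ US]; rewrite card_gt0 => /set0Pn[u].
by rewrite inE US => /andP[/forall_inP uS]; apply: contraL => /uS.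
Qed.

Lemma greedy_resolves S : greedy S [set v] -> resolves S.
Proof.
move=> /greedy_unresolved[vS US]; split=> // u uv.
have := US u; rewrite inE (negbTE uv) => /esym/negbT.
by rewrite negb_forall => /existsP[w]; rewrite negb_imply negbK => /andP[]; exists w.
Qed.

Lemma greedy_full S U : greedy S U ->
  (forall w, w != v -> #|U :&: sep w| = 0) -> U = [set v].
Proof.
move=> gSU U0; apply/setP => u; rewrite inE; have [->|uv] := eqVneq.
  exact: greedy_mem gSU.
apply/negbTE/negP => uU; have /eqP := U0 u uv.
by rewrite cards_eq0 => /eqP/setP/(_ u); rewrite !inE uU sep_self.
Qed.

(** A node that separates everything from [v] has the largest possible gain, so the first node
    selected must have the same gain and separates everything as well. *)
Lemma greedy_single S U w : greedy S U -> resolves [set w] ->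
  (S = set0 /\ U = [set: T]) \/ (#|S| = 1 /\ U = [set v]).
Proof.
move=> gSU [/[!inE] vw sw]; rewrite eq_sym in vw.
elim: gSU => [|{}S {}U w' gSU IH w'v Uw' w'max]; first by left.
right; case: IH => [[ES EU]|[_ EU]]; last first.
  move: Uw'; rewrite EU card_gt0 => /set0Pn[u]; rewrite !inE.
  by case/andP=> /eqP->; rewrite (negbTE (sepNv _)).
rewrite {}ES {}EU in gSU Uw' w'max *; rewrite setU0 cards1; split=> //.
have := w'max w vw; rewrite !setTI => le_w.
have sub : sep w' \subset ~: [set v].
  by apply/subsetP => u; rewrite !inE; apply: contraL => /eqP->.
have sepw : ~: [set v] \subset sep w.
  by apply/subsetP => u; rewrite !inE => /sw[w'' /[!inE] /eqP->].
have /eqP -> : sep w' == ~: [set v].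
  by rewrite eqEcard sub (leq_trans (subset_leq_card sepw)).
by rewrite setTD setCK.
Qed.

(** The gains of the nodes of [V] together cover [U] without [v], and the maximal gain is at least
    their average. *)
Lemma greedy_gain U V w : resolves V ->
  (forall w', w' != v -> #|U :&: sep w'| <= #|U :&: sep w|) ->
  #|U| - 1 <= #|V| * #|U :&: sep w|.
Proof.
move=> [vV Vres] wmax.
have sub : U :\ v \subset \bigcup_(w' in V) (U :&: sep w').
  apply/subsetP => u; rewrite !inE => /andP[/Vres[w' w'V uw'] uU].
  by apply/bigcupP; exists w'; rewrite // inE uU.
apply: (@leq_trans #|U :\ v|); first by rewrite (cardsD1 v U); case: (v \in U); lia.
apply: leq_trans (subset_leq_card sub) _.
apply: leq_trans (_ : _ <= \sum_(w1 in V) #|U :&: sep w1|) _.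
  elim/big_ind2: _ => [|x A y B leA leB|//]; first by rewrite cards0.
  by apply: leq_trans (leq_card_setU _ _) _; rewrite leq_add.
rewrite -sum_nat_const; apply: leq_sum => w' w'V; apply: wmax.
by apply: contraNneq vV => <-.
Qed.

End Greedy.

(** * Harmonic sums and the approximation ratio *)

Section Harmonic.
Local Open Scope ring_scope.

Definition harmonic_sum (R : numFieldType) (n : nat) : R := \sum_(i < n) i.+1%:R^-1.

Variable R : realType.

(** The last [c] terms of the sum are at least 1/m each. *)
Lemma harmonic_drop (m c : nat) : (c <= m)%N -> (0 < m)%N ->
  harmonic_sum R (m - c) + c%:R / m%:R <= harmonic_sum R m.
Proof.
move=> le_cm m_gt0; rewrite -[in leRHS](subnK le_cm) /harmonic_sum big_split_ord /=.
rewrite lerD2l mulr_natl -[c in _ *+ c]card_ord -sumr_const.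
apply: ler_sum => i _; rewrite lef_pV2 ?posrE ?ltr0n // ler_nat; have := ltn_ord i; lia.
Qed.

Lemma harmonic_ln n : (0 < n)%N -> harmonic_sum R n <= 1 + ln n%:R.
Proof.
case: n => // n _; elim: n => [|n IH].
  by rewrite /harmonic_sum big_ord1 ln1 invr1 addr0.
rewrite /harmonic_sum big_ord_recr /= -/(harmonic_sum R n.+1).
apply: le_trans (lerD IH (lexx _)) _; rewrite -addrA lerD2l.
have n1 : 0 < n.+1%:R :> R by rewrite ltr0n.
have n2 : 0 < n.+2%:R :> R by rewrite ltr0n.
rewrite -lerBrDl -ln_div ?posrE //.
(* The inequality ln (1 + x) <= x is used at x = - 1/(n + 2), where 1 + x is the inverse (n + 1)/(n
   + 2) of the ratio. *)
rewrite -[leLHS]opprK lerNl -lnV ?posrE ?divr_gt0 // invf_div.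
have -> : n.+1%:R / n.+2%:R = 1 + - n.+2%:R^-1 :> R.
  by rewrite -[n.+1%:R](addrK 1) natr1 mulrDl mulNr mul1r divff ?gt_eqF.
by apply: le_ln1Dx; rewrite ltrN2 invf_lt1 // ltr1n.
Qed.

(** The left side is a potential that no selection increases: a gain of c raises [#|S|] by 1 and
    lowers the harmonic term by at least |V| c / (|U| - 1), which [greedy_gain] shows to be at least
    1. *)
Lemma greedy_ratio (T : finType) (v : T) (sep : T -> {set T}) (S U V : {set T}) :
  (forall w, v \notin sep w) -> greedy v sep S U -> resolves v sep V ->
  #|S|%:R + #|V|%:R * harmonic_sum R (#|U| - 1) <= #|V|%:R * harmonic_sum R (#|T| - 1).
Proof.
move=> sepNv gSU resV; elim: gSU => [|{}S {}U w gSU IH wv Uw wmax].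
  by rewrite cards0 add0r cardsT.
apply: le_trans IH; have vU := greedy_mem sepNv gSU.
rewrite cardsU1 (greedy_fresh gSU Uw) natrD [1 + _]addrC -addrA lerD2l.
have le_c : (#|U :&: sep w| <= #|U| - 1)%N.
  rewrite (cardsD1 v U) vU addKn; apply/subset_leq_card/subsetP => u.
  by rewrite !inE => /andP[-> uw]; rewrite andbT; apply: contraTneq uw => ->.
have U_gt0 : (0 < #|U| - 1)%N by apply: leq_trans le_c.
have -> : (#|U :\: sep w| - 1 = (#|U| - 1) - #|U :&: sep w|)%N.
  by rewrite cardsD; lia.
apply: le_trans (ler_wpM2l (ler0n _ _) (harmonic_drop le_c U_gt0)).
rewrite mulrDr addrC lerD2l mulrA ler_pdivlMr ?ltr0n // mul1r -natrM ler_nat.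
exact: (greedy_gain resV wmax).
Qed.

End Harmonic.

(** * The greedy algorithm on the machine *)

(** Rule for a loop that fills the array at [b], iteration [k] changing the cell [b + k] alone. *)
Lemma forP_array b g i p c s n : wf (For i p c) -> s.1 0 = n ->
    (forall k s', k < n ->
       (forall x, x \notin writes (For i p c) -> s'.1 x = s.1 x) ->
       s'.1 i = k -> s'.1 p = k * n + 1 ->
       (forall a, s'.2 a = if b <= a < b + k then g (a - b) else s.2 a) ->
       forall a, (run c s').2 a = if a == b + k then g k else s'.2 a) ->
  forall a, (run (For i p c) s).2 a = if b <= a < b + n then g (a - b) else s.2 a.
Proof.
move=> wF <- body; apply: (@forP_mem (fun k m => forall a,
  m a = if b <= a < b + k then g (a - b) else s.2 a) i p c s wF) => [a|].
  by rewrite addn0; case: leqP => //= /leq_gtF->.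
move=> k s' lt_k F ri rp I a; rewrite (body k) // I.
case: eqP => [->|ak]; first by rewrite leq_addr addnS leqnn addKn.
by rewrite addnS ltnS [a <= _]leq_eqVlt; move/eqP/negbTE: ak => ->.
Qed.

(* Registers 0, 2 and 23 hold [n], 1 and 0. Registers 3 to 6 point to four arrays
   of size [n] stored behind the matrix: the nodes separated from the current
   node [v], the numbers of nodes that each node would newly separate from [v],
   the nodes selected for [v], and the best selection so far, whose size is in
   register 7. Register 8 holds [v], and 22 the size of the current selection.
   Registers 18 and 19 hold the node selected last and the address of its row,
   17 the number of nodes it has still to separate from [v], and 20 the one of
   them that is dealt with next. *)
Definition layout (n : nat) : seq nat :=
  let b := n * n + 1 in [:: n; 0; 1; b; b + n; b + n + n; b + n + n + n].

(** Register 1 is scratch, so entry 1 of [layout] is a mere filler. Register 23 lies past the end of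
    that list, where [nth] yields the default 0. *)
Definition layout_regs := [:: 0; 2; 3; 4; 5; 6; 23].

Definition laid_out (n : nat) (s : store) : Prop :=
  {in layout_regs, forall x, s.1 x = nth 0 (layout n) x}.

Lemma laid_out_frame n (W : seq nat) s s' : all [predC W] layout_regs ->
  (forall x, x \notin W -> s'.1 x = s.1 x) -> laid_out n s -> laid_out n s'.
Proof.
by move=> /allP LW F L x xL; rewrite F ?L //; apply: LW.
Qed.

Lemma laid_out_run n c s : all [predC writes c] layout_regs ->
  laid_out n s -> laid_out n (run c s).
Proof. by move=> cL; apply: laid_out_frame cL _; exact: run_frame. Qed.

(** Register 14 receives the absolute difference of two cells of the row at [p]; it is nonzero
    exactly if the node of that row separates the two column nodes. *)
Definition compare_cells p x y :=
  [:: Add 14 p x; Fetch 14 14; Add 15 p y; Fetch 15 15;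
      Sub 16 14 15; Sub 15 15 14; Add 14 16 15].

Lemma absdiff_eq0 x y : (x - y + (y - x) == 0) = (x == y).
Proof. by lia. Qed.

Definition clear b := For 10 11 (Block [:: Add 14 b 10; Store 14 23]).

Definition copy a b :=
  For 10 11 (Block [:: Add 14 a 10; Fetch 15 14; Add 14 b 10; Store 14 15]).

Definition count_separated :=
  For 10 11
    (Seq (Block [:: Const 21 0])
    (Seq (For 12 13 (Seq (Block (compare_cells 11 12 8))
                         (When 14 (Block [:: Add 21 21 2]))))
         (Block [:: Add 14 4 10; Store 14 21]))).

(** Register 14 is |w - v| and keeps [v] itself from being selected. Adding register 23, which holds
    0, is a move. *)
Definition arg_max :=
  For 12 13
    (Seq (Block [:: Sub 14 12 8; Sub 15 8 12; Add 14 14 15; Add 15 4 12;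
                    Fetch 15 15; Sub 16 15 17])
         (When 14 (When 16 (Block [:: Add 17 15 23; Add 18 12 23; Add 19 13 23])))).

(** The difference 1 - r17 is nonzero only if the node selected last has nothing left to separate.
    If the maximal gain is 0 as well, register 17 stays 0 and the selection is complete. *)
Definition select :=
  Seq (Block [:: Sub 14 2 17])
      (When 14 (Seq arg_max
        (When 17 (Block [:: Add 14 5 18; Store 14 2; Add 22 22 2])))).

Definition scan :=
  For 12 13
    (Seq (Block (compare_cells 19 12 8))
    (Seq (Block [:: Add 15 3 12; Fetch 15 15; Sub 15 2 15])
         (When 14 (When 15 (Block [:: Add 20 12 23]))))).

(** Once the node in register 20 is separated, each node that would have separated it from [v] has
    one point fewer to gain. *)
Definition decrement :=
  For 12 13
    (Seq (Block (compare_cells 13 20 8))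
         (When 14 (Block [:: Add 14 4 12; Fetch 15 14; Sub 15 15 2; Store 14 15]))).

Definition cover :=
  When 17 (Seq scan (Seq
    (Block [:: Add 14 3 20; Store 14 2; Sub 17 17 2]) decrement)).

Definition greedy_step := Seq select cover.

Definition greedy_for_node :=
  Seq (clear 3) (Seq (clear 5) (Seq count_separated
    (Seq (Block [:: Const 17 0; Const 22 0]) (For 10 11 greedy_step)))).

Definition keep_best :=
  Seq (Block [:: Sub 14 7 22])
      (When 14 (Seq (Block [:: Add 7 22 23]) (copy 5 6))).

Definition greedy_for_all :=
  For 8 9 (Seq greedy_for_node keep_best).

Definition flags (n : nat) (m : nat -> nat) (b : nat) : {set 'I_n} :=
  [set i : 'I_n | m (b + i) != 0].

(** * Correctness of the greedy programs *)

Section RamGreedy.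

Variables (n : nat) (d : nat -> nat -> nat).

Let b_cov := n * n + 1.
Let b_cnt := b_cov + n.
Let b_sel := b_cnt + n.
Let b_best := b_sel + n.

Definition holds_matrix (m : nat -> nat) :=
  forall i j, i < n -> j < n -> m (cell n i j) = d i j.

Lemma cell_lt i j : i < n -> j < n -> cell n i j < b_cov.
Proof. by rewrite /cell /b_cov => lt_i lt_j; nia. Qed.

Lemma holds_matrix_eq m m' :
  (forall a, a < b_cov -> m' a = m a) -> holds_matrix m -> holds_matrix m'.
Proof. by move=> E M i j lt_i lt_j; rewrite E ?M ?cell_lt. Qed.

Lemma run_clear r s : laid_out n s -> r \notin writes (clear r) ->
  forall a, (run (clear r) s).2 a = if s.1 r <= a < s.1 r + n then 0 else s.2 a.
Proof.
move=> L rW a; apply: (@forP_array (s.1 r) (fun=> 0)); rewrite ?(L 0) //.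
move=> {a} k s1 lt_k F r10 _ _ a.
have := F r rW; have r23 := F 23 isT; rewrite (L 23) // in r23.
case: s1 r10 r23 {F} => re m /= r10 r23 rr.
by rewrite ?run_Block /effects /= rr r10 r23.
Qed.

Lemma run_copy ra rb s : laid_out n s -> ra \notin writes (copy ra rb) ->
    rb \notin writes (copy ra rb) -> n <= s.1 ra - s.1 rb \/ s.1 ra + n <= s.1 rb ->
  forall a, (run (copy ra rb) s).2 a =
    if s.1 rb <= a < s.1 rb + n then s.2 (s.1 ra + (a - s.1 rb)) else s.2 a.
Proof.
move=> L raW rbW disj a.
apply: (@forP_array (s.1 rb) (fun k => s.2 (s.1 ra + k))); rewrite ?(L 0) //.
move=> {a} k s1 lt_k F r10 _ I a.
have ea := F ra raW; have eb := F rb rbW.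
have b14 : (rb == 14) = false by apply/negbTE; apply: contraNneq rbW => ->.
have b15 : (rb == 15) = false by apply/negbTE; apply: contraNneq rbW => ->.
have Ia : s1.2 (s.1 ra + k) = s.2 (s.1 ra + k) by rewrite I; case: ifP => //; lia.
case: s1 r10 ea eb Ia {I F} => re m /= r10 ea eb Ia.
by rewrite ?run_Block /effects /= b15 b14 ea eb r10 Ia.
Qed.

Definition separated (v w : 'I_n) : {set 'I_n} := [set u : 'I_n | d w u != d w v].

Lemma run_count_separated s v : laid_out n s -> s.1 8 = v -> v < n -> holds_matrix s.2 ->
  forall a, (run count_separated s).2 a =
    if b_cnt <= a < b_cnt + n then
      \sum_(0 <= u < n) (d (a - b_cnt) u != d (a - b_cnt) v) else s.2 a.
Proof.
move=> L r8 lt_v M.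
apply: (@forP_array b_cnt (fun w => \sum_(0 <= u < n) (d w u != d w v)));
  rewrite ?L // => w s1 lt_w F r10 r11 I a.
have M1 : holds_matrix s1.2.
  by apply: holds_matrix_eq M => a' lt_a'; rewrite I; case: ifP => //; lia.
have L1 : laid_out n s1 by apply: laid_out_frame F L.
have r81 : s1.1 8 = v by rewrite F.
rewrite !run_Seq; set s2 := run (Block _) s1.
have L2 : laid_out n s2 by apply: laid_out_run L1.
have E2 : s2.2 = s1.2 by rewrite /s2; case: (s1).
have r82 : s2.1 8 = v by rewrite /s2 run_frame.
have r102 : s2.1 10 = w by rewrite /s2 run_frame.
have r112 : s2.1 11 = w * n + 1 by rewrite /s2 run_frame.
have r212 : s2.1 21 = 0 by rewrite /s2; case: (s1).
have := @forP (fun k s => s.2 = s1.2 /\ s.1 21 = \sum_(0 <= u < k) (d w u != d w v))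
  12 13 (Seq (Block (compare_cells 11 12 8)) (When 14 (Block [:: Add 21 21 2]))) s2 isT.
rewrite (L2 0) //= => -[].
- by move=> k r r' m F' /= [<- <-]; rewrite F'.
- by rewrite big_geq.
- move=> u s3 lt_u F3 r12 _ [E3 r21].
  have r11_3 : s3.1 11 = w * n + 1 by rewrite F3.
  have r8_3 : s3.1 8 = v by rewrite F3.
  have r2_3 : s3.1 2 = 1 by rewrite F3 // L2.
  case: s3 r12 E3 r21 r11_3 r8_3 r2_3 {F3} => r m /= r12 E3 r21 r11_3 r8_3 r2_3.
  rewrite run_Seq run_Block /effects /= run_When /= r11_3 r12 r8_3 absdiff_eq0 E3.
  rewrite -!/(cell n _ _) !M1 // big_nat_recr //= -r21.
  case: eqP => _ /=; first by rewrite addn0.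
  by rewrite ?run_Block /effects /= r2_3.
rewrite -/(run _ _); set s3 := run (For 12 13 _) s2 => -[E3 r21] _.
have r4 : s3.1 4 = b_cnt by rewrite /s3 run_frame // L2.
have r10_3 : s3.1 10 = w by rewrite /s3 run_frame.
case: s3 E3 r21 r4 r10_3 => r m /= -> r21 r4 r10_3.
by rewrite ?run_Block /effects /= r4 r10_3 r21.
Qed.

Lemma run_arg_max s (v : 'I_n) : laid_out n s -> s.1 8 = v -> s.1 17 = 0 ->
  let s' := run arg_max s in
  [/\ s'.2 = s.2, forall w : 'I_n, w != v -> s.2 (b_cnt + w) <= s'.1 17
    & s'.1 17 = 0 \/ exists w : 'I_n, [/\ w != v, s'.1 17 = s.2 (b_cnt + w),
        s'.1 18 = w & s'.1 19 = w * n + 1]].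
Proof.
move=> L r8 r17.
pose I k s' := [/\ s'.2 = s.2,
    forall w : 'I_n, w < k -> w != v -> s.2 (b_cnt + w) <= s'.1 17
  & s'.1 17 = 0 \/ exists w : 'I_n, [/\ w != v, s'.1 17 = s.2 (b_cnt + w),
        s'.1 18 = w & s'.1 19 = w * n + 1]].
suff [Im Ib Iw] : I n (run arg_max s) by split=> // w; apply: Ib.
have := @forP I 12 13 _ s (erefl : wf arg_max).
rewrite (L 0) //= => -[] //.
- by move=> k r r' m F; rewrite /I /= !F.
- by split=> //; left.
move=> k s1 lt_k F r12 r13 [Im Ib Iw].
have r8_1 : s1.1 8 = v by rewrite F.
have r4_1 : s1.1 4 = b_cnt by rewrite F // L.
have r23_1 : s1.1 23 = 0 by rewrite F // L.
case: s1 r12 r13 Im Ib Iw r8_1 r4_1 r23_1 {F} => r m /= r12 r13 -> Ib Iw r8_1 r4_1 r23_1.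
rewrite ?run_Seq ?run_Block /effects /= ?run_When /= ?run_When /= ?run_Block /effects /=.
rewrite r8_1 r4_1 r12 r13 r23_1 absdiff_eq0 subn_eq0 !addn0.
have [kv|kv] := eqVneq k v.
  split=> //= w; rewrite ltnS leq_eqVlt => /predU1P[wk|]; last exact: Ib.
  by rewrite -val_eqE /= wk kv eqxx.
case: leqP => /= le_m.
  split=> //= w; rewrite ltnS leq_eqVlt => /predU1P[->//|]; exact: Ib.
split=> //= [w|]; last first.
  by right; exists (Ordinal lt_k).
rewrite ltnS leq_eqVlt => /predU1P[->//|lt_w wv].
by apply: leq_trans (ltnW le_m); apply: Ib.
Qed.

Definition unseparated (m : nat -> nat) : {set 'I_n} := ~: flags n m b_cov.

Lemma run_scan s (v w : 'I_n) : laid_out n s -> holds_matrix s.2 ->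
    s.1 8 = v -> s.1 19 = w * n + 1 ->
  let s' := run scan s in
  s'.2 = s.2 /\ (0 < #|unseparated s.2 :&: separated v w| ->
    exists2 x : 'I_n, s'.1 20 = x & x \in unseparated s.2 :&: separated v w).
Proof.
move=> L M r8 r19; pose A := unseparated s.2 :&: separated v w.
pose I k (s' : store) := s'.2 = s.2 /\ (forall u : 'I_n, u < k -> u \in A ->
  exists2 x : 'I_n, s'.1 20 = x & x \in A).
suff [Im Ix] : I n (run scan s).
  by split=> //; rewrite card_gt0 => /set0Pn[u uA]; apply: (Ix u).
have := @forP I 12 13 _ s (erefl : wf scan).
rewrite (L 0) //= => -[] //.
  by move=> k r r' m F; rewrite /I /= !F.
move=> k s1 lt_k F r12 _ [Im Ix].
have r8_1 : s1.1 8 = v by rewrite F.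
have r19_1 : s1.1 19 = w * n + 1 by rewrite F.
have r2_1 : s1.1 2 = 1 by rewrite F // L.
have r3_1 : s1.1 3 = b_cov by rewrite F // L.
have r23_1 : s1.1 23 = 0 by rewrite F // L.
have kA : (Ordinal lt_k \in A) = (d w k != d w v) && (s.2 (b_cov + k) == 0).
  by rewrite !inE negbK andbC.
case: s1 r12 Im Ix r8_1 r19_1 r2_1 r3_1 r23_1 {F}
  => r m /= r12 -> Ix r8_1 r19_1 r2_1 r3_1 r23_1.
rewrite ?run_Seq ?run_Block /effects /= ?run_Seq ?run_Block /effects /=.
rewrite ?run_When /= ?run_When /= ?run_Block /effects /=.
rewrite r8_1 r19_1 r2_1 r3_1 r12 r23_1 absdiff_eq0 -!/(cell n w _) !(M w) // addn0.
rewrite subn_eq0 lt0n.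
case: eqP kA => /= [_ kA|_]; last case: eqP => /= _ kA.
- split=> //= u; rewrite ltnS leq_eqVlt => /predU1P[uk uA|]; last exact: Ix.
  by have uE : u = Ordinal lt_k by [apply: val_inj]; rewrite uE kA in uA.
- by split=> //= u _ _; exists (Ordinal lt_k).
- split=> //= u; rewrite ltnS leq_eqVlt => /predU1P[uk uA|]; last exact: Ix.
  by have uE : u = Ordinal lt_k by [apply: val_inj]; rewrite uE kA in uA.
Qed.

Lemma run_decrement s (v x : 'I_n) : laid_out n s -> holds_matrix s.2 ->
    s.1 8 = v -> s.1 20 = x ->
  forall a, (run decrement s).2 a =
    if b_cnt <= a < b_cnt + n then s.2 a - (d (a - b_cnt) x != d (a - b_cnt) v)
    else s.2 a.
Proof.
move=> L M r8 r20 a.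
have E := @forP_array b_cnt (fun w => s.2 (b_cnt + w) - (d w x != d w v))
  12 13 _ s n (erefl : wf decrement) _ _ a.
rewrite {}E ?(L 0) //; first by case: ifP => // /andP[le_a _]; rewrite subnKC.
move=> {a} k s1 lt_k F r12 r13 I a.
have M1 : holds_matrix s1.2.
  by apply: holds_matrix_eq M => a' lt_a'; rewrite I; case: ifP => //; lia.
have mk : s1.2 (b_cnt + k) = s.2 (b_cnt + k) by rewrite I; case: ifP => //; lia.
have r8_1 : s1.1 8 = v by rewrite F.
have r20_1 : s1.1 20 = x by rewrite F.
have r2_1 : s1.1 2 = 1 by rewrite F // L.
have r4_1 : s1.1 4 = b_cnt by rewrite F // L.
case: s1 r12 r13 M1 mk r8_1 r20_1 r2_1 r4_1 {F I}
  => r m /= r12 r13 M1 mk r8_1 r20_1 r2_1 r4_1.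
rewrite ?run_Seq ?run_Block /effects /= ?run_When /= ?run_Block /effects /=.
rewrite r8_1 r20_1 r2_1 r4_1 r13 r12 absdiff_eq0 -!/(cell n _ _) !M1 //.
case: eqP => _ /=; last by rewrite mk.
by rewrite subn0; case: eqP => // ->.
Qed.

Hypothesis d_refl : forall i, i < n -> d i i = 0.
Hypothesis d_gt0 : forall i j, i < n -> j < n -> i != j -> 0 < d i j.

Lemma separated_self (v w : 'I_n) : w != v -> w \in separated v w.
Proof. by move=> wv; rewrite inE d_refl // eq_sym -lt0n d_gt0. Qed.

Lemma separatedN (v w : 'I_n) : v \notin separated v w.
Proof. by rewrite inE eqxx. Qed.

Lemma flags_eq m m' b : (forall i : 'I_n, m' (b + i) = m (b + i)) ->
  flags n m' b = flags n m b.
Proof. by move=> E; apply/setP => i; rewrite !inE E. Qed.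

Lemma flags_upd m m' b (x : 'I_n) : m' (b + x) != 0 ->
  (forall i : 'I_n, i != x -> m' (b + i) = m (b + i)) ->
  flags n m' b = x |: flags n m b.
Proof.
move=> mx E; apply/setP => i; rewrite !inE.
by have [->|ix] := eqVneq i x; rewrite ?mx ?E.
Qed.

(** Here [m0] is the memory before the run for [v]: the matrix and the best selection so far have to
    survive it. *)
Definition consistent (v : 'I_n) (m0 : nat -> nat) (s : store) :=
  [/\ forall a, (a < b_cov) || (b_best <= a) -> s.2 a = m0 a,
      forall w : 'I_n, s.2 (b_cnt + w) = #|unseparated s.2 :&: separated v w|
    & s.1 22 = #|flags n s.2 b_sel|].

Definition selecting (v : 'I_n) (s : store) :=
  s.1 17 = 0 /\
  greedy v (separated v) (flags n s.2 b_sel) (unseparated s.2).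

(** The node [w] is already selected, but its points are flagged one per round. The greedy state is
    therefore ahead of the flags by the points still unflagged, whose number is in register 17. *)
Definition covering (v : 'I_n) (s : store) := exists w : 'I_n,
  [/\ s.1 19 = w * n + 1, 0 < s.1 17,
      s.1 17 = #|unseparated s.2 :&: separated v w|
    & greedy v (separated v) (flags n s.2 b_sel) (unseparated s.2 :\: separated v w)].

Lemma run_select s (v : 'I_n) m0 : laid_out n s -> s.1 8 = v -> consistent v m0 s ->
    selecting v s \/ covering v s ->
  let s' := run select s in
  [/\ consistent v m0 s', unseparated s'.2 = unseparated s.2
    & selecting v s' /\ unseparated s'.2 = [set v] \/ covering v s'].
Proof.
move=> L r8 C ph; rewrite /select run_Seq; set s1 := run (Block _) s.
have L1 : laid_out n s1 by apply: laid_out_run L.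
have r8_1 : s1.1 8 = v by rewrite /s1 run_frame.
have [r17 r19 r22] : [/\ s1.1 17 = s.1 17, s1.1 19 = s.1 19 & s1.1 22 = s.1 22].
  by rewrite /s1 !run_frame.
have [E1 r14] : s1.2 = s.2 /\ s1.1 14 = 1 - s.1 17.
  by rewrite /s1 run_Block /effects /=; have := L 2 isT; case: (s) => r m /= ->.
have {C} C : consistent v m0 s1 by rewrite /consistent E1 r22.
have {}ph : selecting v s1 \/ covering v s1.
  by rewrite /selecting /covering r17 r19 E1.
rewrite -E1 run_When r14 -r17; case: ph => [[r17_0 gr]|cov] /=; last first.
  have [w [_ r17_gt0 _ _]] := cov.
  by rewrite subn_eq0 r17_gt0; split=> //; right.
rewrite r17_0 /= run_Seq; have [] := run_arg_max L1 r8_1 r17_0.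
have [L2 r5 r22_2] : [/\ laid_out n (run arg_max s1), (run arg_max s1).1 5 = b_sel
    & (run arg_max s1).1 22 = s1.1 22].
  by split; [apply: laid_out_run L1 | rewrite run_frame ?(L1 5) | rewrite run_frame].
move: (L2 2 isT) (L2 23 isT) r5 r22_2 => {L2}; case: (run arg_max s1) => r m /=.
move=> r2 r23 r5 r22_2 -> max_w pick_w.
have [Cm Ccnt Cr22] := C.
rewrite run_When /=; case: eqP => r17'.
  (* Every node other than [v] separates itself from [v], so if no gain is positive, only [v] is
     left. *)
  have U_v : unseparated s1.2 = [set v].
    apply: (greedy_full (@separated_self v) (@separatedN v) gr) => w wv.
    by apply/eqP; rewrite -leqn0 -Ccnt -r17' max_w.
  by split=> //; [split; rewrite //= r22_2|left].
case: pick_w => [//|[w [wv r17w r18 r19']]].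
rewrite ?run_Block /effects /= r2 r5 r18 r22_2.
set m' := upd s1.2 _ _.
have U_m' : unseparated m' = unseparated s1.2.
  congr (~: _); apply: flags_eq => i; rewrite /m' /=.
  by case: eqP => //; have := ltn_ord i; lia.
have S_m' : flags n m' b_sel = w |: flags n s1.2 b_sel.
  apply: flags_upd => [|i iw]; rewrite /m' /= ?eqxx //.
  by rewrite eqn_add2l (inj_eq val_inj) (negbTE iw).
have w_gt0 : 0 < #|unseparated s1.2 :&: separated v w|.
  by rewrite -Ccnt -r17w lt0n; apply/eqP.
split=> //.
  split=> [a a_out|w'|] /=; rewrite ?U_m'.
  - rewrite /m' /= Cm //; case: eqP => // a_eq.
    by have := ltn_ord w; move: a_out; rewrite a_eq; lia.
  - by rewrite -Ccnt /m' /=; case: eqP => // E; have := ltn_ord w'; lia.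
  - by rewrite S_m' cardsU1 (greedy_fresh gr w_gt0) addnC Cr22.
right; exists w; rewrite /= U_m' S_m'; split; rewrite ?lt0n //; first exact/eqP.
  by rewrite r17w Ccnt.
apply: greedy_select => // w' w'v; rewrite -!Ccnt -r17w; exact: max_w.
Qed.

Lemma run_cover s (v : 'I_n) m0 : laid_out n s -> s.1 8 = v -> holds_matrix m0 ->
    consistent v m0 s -> selecting v s /\ unseparated s.2 = [set v] \/ covering v s ->
  let s' := run cover s in
  [/\ consistent v m0 s', selecting v s' \/ covering v s'
    & unseparated s'.2 = [set v] \/ #|unseparated s'.2| < #|unseparated s.2|].
Proof.
move=> L r8 M C ph; rewrite /cover run_When.
case: ph => [[sel U_v]|[w [r19 r17_gt0 r17 gr]]].
  by have [-> _] := sel; split=> //; left.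
have [Cm Ccnt Cr22] := C.
rewrite eqn0Ngt r17_gt0 /= 2!run_Seq.
have Ms : holds_matrix s.2 by apply: holds_matrix_eq M => a lt_a; rewrite Cm ?lt_a.
have [E1] := run_scan L Ms r8 r19; rewrite -r17 => /(_ r17_gt0)[x r20 xA].
have [L1 r8_1 r17_1] : [/\ laid_out n (run scan s), (run scan s).1 8 = v
    & (run scan s).1 17 = s.1 17].
  by split; [apply: laid_out_run L | rewrite run_frame | rewrite run_frame].
have [r19_1 r22_1] : (run scan s).1 19 = s.1 19 /\ (run scan s).1 22 = s.1 22.
  by rewrite !run_frame.
move: E1 r20 L1 r8_1 r17_1 r19_1 r22_1.
case: (run scan s) => r m /= -> r20 L1 r8_1 r17_1 r19_1 r22_1.
set s2 := run (Block _) _.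
have [L2 r8_2] : laid_out n s2 /\ s2.1 8 = v.
  by split; [apply: laid_out_run L1 | rewrite run_frame].
have [r17_2 r19_2 r20_2 r22_2] : [/\ s2.1 17 = s.1 17 - 1, s2.1 19 = s.1 19,
    s2.1 20 = x & s2.1 22 = s.1 22].
  by rewrite /s2 ?run_Block /effects /= (L1 2 isT : r 2 = 1) r17_1.
have E2 a : s2.2 a = if a == b_cov + x then 1 else s.2 a.
  by rewrite /s2 ?run_Block /effects /= (L1 2 isT : r 2 = 1) (L1 3 isT : r 3 = b_cov) r20.
clearbody s2; have M2 : holds_matrix s2.2.
  by apply: holds_matrix_eq Ms => a lt_a; rewrite E2; case: eqP => // a_eq; lia.
have E3 := run_decrement L2 M2 r8_2 r20_2.
have [r17_3 r19_3 r22_3] : [/\ (run decrement s2).1 17 = s.1 17 - 1,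
    (run decrement s2).1 19 = s.1 19 & (run decrement s2).1 22 = s.1 22].
  by split; rewrite run_frame.
case: (run decrement s2) E3 r17_3 r19_3 r22_3 => r' m' /= E3 r17_3 r19_3 r22_3.
pose U := unseparated s.2; have xU : x \in U by case/setIP: xA.
have U' : unseparated m' = U :\ x.
  apply/setP => i; rewrite !inE E3; case: ifP => [|_]; first by have := ltn_ord i; lia.
  by rewrite E2 eqn_add2l (inj_eq val_inj) !negbK; case: (eqVneq i x) => //.
have S' : flags n m' b_sel = flags n s.2 b_sel.
  apply: flags_eq => i; rewrite E3; case: ifP => [|_]; first by lia.
  by rewrite E2; case: eqP => //; have := ltn_ord x; lia.
have card_sep w' : #|(U :\ x) :&: separated v w'|
    = #|U :&: separated v w'| - (d w' x != d w' v).
  rewrite setIDAC (cardsD1 x (U :&: _)) !inE negbK.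
  by move: xU; rewrite !inE negbK => -> /=; rewrite addKn.
split=> /=; rewrite ?/covering ?/selecting /= ?U' ?S'.
- split=> /= [a a_out|w'|]; rewrite ?U' ?S' ?r22_3 //.
    rewrite E3 E2 -Cm //; have := ltn_ord x; move: a_out.
    by case: ifP => [|_]; [lia|case: eqP => //; lia].
  rewrite E3 leq_addr ltn_add2l ltn_ord /= addKn E2 card_sep -Ccnt.
  by case: eqP => //; have := ltn_ord x; lia.
- have EU : (U :\ x) :\: separated v w = U :\: separated v w.
    apply/setP => i; rewrite !inE; case: (eqVneq i x) => // ->.
    by case/setIP: xA => _; rewrite inE => ->.
  have r17' : r' 17 = #|(U :\ x) :&: separated v w|.
    rewrite r17_3 card_sep r17.
    by case/setIP: xA => _; rewrite inE => ->.
  (* When the count reaches 0, the flags have caught up with the greedy state and the next round may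
     select again. *)
  have [r17_0|r17_gt0'] := posnP (r' 17).
    left; split=> //; have : (U :\ x) :\: separated v w = U :\ x.
      by apply/setDidPl; rewrite -setI_eq0 -cards_eq0 -r17' r17_0.
    by rewrite EU => <-.
  by right; exists w; rewrite EU r19_3; split.
- by right; rewrite (cardsD1 x U) xU.
Qed.

Lemma run_greedy_for_node s (v : 'I_n) : laid_out n s -> s.1 8 = v -> holds_matrix s.2 ->
  let s' := run greedy_for_node s in
  [/\ forall a, (a < b_cov) || (b_best <= a) -> s'.2 a = s.2 a,
      greedy v (separated v) (flags n s'.2 b_sel) [set v]
    & s'.1 22 = #|flags n s'.2 b_sel|].
Proof.
move=> L r8 M; rewrite /greedy_for_node 4!run_Seq.
set s1 := run (clear 3) s.
have L1 : laid_out n s1 by apply: laid_out_run L.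
have E1 a : s1.2 a = if b_cov <= a < b_cov + n then 0 else s.2 a.
  by rewrite /s1 run_clear ?(L 3).
have r8_1 : s1.1 8 = v by rewrite run_frame.
clearbody s1; set s2 := run (clear 5) s1.
have L2 : laid_out n s2 by apply: laid_out_run L1.
have E2 a : s2.2 a = if b_sel <= a < b_sel + n then 0 else s1.2 a.
  by rewrite /s2 run_clear ?(L1 5).
have r8_2 : s2.1 8 = v by rewrite run_frame.
clearbody s2; set s3 := run count_separated s2.
have L3 : laid_out n s3 by apply: laid_out_run L2.
have M2 : holds_matrix s2.2.
  apply: holds_matrix_eq M => a lt_a; rewrite E2 E1.
  by do 2?[case: ifP => [|_]]; rewrite //; lia.
have E3 := run_count_separated L2 r8_2 (ltn_ord v) M2; rewrite -/s3 in E3.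
have r8_3 : s3.1 8 = v by rewrite run_frame.
clearbody s3; set s4 := run (Block _) s3.
have L4 : laid_out n s4 by apply: laid_out_run L3.
have r8_4 : s4.1 8 = v by rewrite run_frame.
have [r17 r22 E4] : [/\ s4.1 17 = 0, s4.1 22 = 0 & s4.2 = s3.2].
  by rewrite /s4 ?run_Block /effects /=; case: (s3).
clearbody s4.
have U4 : unseparated s4.2 = setT.
  apply/setP => i; have := ltn_ord i; rewrite !inE negbK E4 E3 E2 E1 => lt_i.
  by rewrite leq_addr ltn_add2l lt_i /=; do 2?[case: ifP => [|_]]; rewrite //; lia.
have S4 : flags n s4.2 b_sel = set0.
  apply/setP => i; have := ltn_ord i; rewrite !inE E4 E3 E2 => lt_i.
  by rewrite leq_addr ltn_add2l lt_i /=; case: ifP => [|_] //; lia.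
have C4 : consistent v s.2 s4.
  split=> [a a_out|w|]; rewrite ?S4 ?cards0 ?U4 ?setTI //.
    rewrite E4 E3 E2 E1; move: a_out.
    by do 3?[case: ifP => [|_]]; rewrite //; lia.
  rewrite E4 E3 leq_addr ltn_add2l ltn_ord addKn big_mkord -sum1_card.
  by rewrite [RHS]big_mkcond /=; apply: eq_bigr => u _; rewrite inE; case: eqP.
have sel4 : selecting v s4 by split; rewrite // S4 U4; apply: greedy_start.
(* Each round flags a new node unless only [v] is left. After n rounds the second alternative would
   leave no unflagged node at all, although [v] never gets flagged. *)
pose I k s' := [/\ consistent v s.2 s', selecting v s' \/ covering v s'
  & unseparated s'.2 = [set v] \/ #|unseparated s'.2| + k <= n].
have := @forP I 10 11 greedy_step s4 isT.
rewrite (L4 0) //= => -[].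
- by move=> k r r' m F; rewrite /I /consistent /selecting /covering /= !F.
- by split=> //; [left|right; rewrite U4 cardsT card_ord addn0].
- move=> k s5 lt_k F _ _ [C5 ph5 card5].
  have L5 : laid_out n s5 by apply: laid_out_frame F L4.
  have r8_5 : s5.1 8 = v by rewrite F.
  rewrite /greedy_step run_Seq.
  have [C6 U6 ph6] := run_select L5 r8_5 C5 ph5.
  have L6 : laid_out n (run select s5) by apply: laid_out_run L5.
  have r8_6 : (run select s5).1 8 = v by rewrite run_frame.
  have [C7 ph7 card7] := run_cover L6 r8_6 M C6 ph6.
  split=> //; case: card7; first by left.
  rewrite U6; case: card5 => [->|card5 lt_U]; last by right; lia.
  rewrite cards1 ltnS leqn0 cards_eq0 => /eqP U0.
  have : v \in unseparated (run cover (run select s5)).2.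
    case: ph7 => [[_ /(greedy_mem (@separatedN v))//]|[w [_ _ _ gr]]].
    by have := greedy_mem (@separatedN v) gr; rewrite inE => /andP[].
  by rewrite U0 inE.
set s' := run _ s4; move=> [[Cm _ Cr] ph cardU] _; split=> //.
have vU : v \in unseparated s'.2.
  case: ph => [[_ /(greedy_mem (@separatedN v))//]|[w [_ _ _ gr]]].
  by have := greedy_mem (@separatedN v) gr; rewrite inE => /andP[].
have U_v : unseparated s'.2 = [set v].
  by case: cardU => //; rewrite (cardsD1 v) vU; lia.
case: ph => [[_]|[w [_ + r17' _]]]; first by rewrite U_v.
rewrite {}r17' U_v card_gt0 => /set0Pn[u]; rewrite inE => /andP[/set1P->].
by rewrite (negbTE (separatedN v w)).
Qed.

Lemma run_keep_best s : laid_out n s ->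
  let s' := run keep_best s in
  (forall a, a < b_best -> s'.2 a = s.2 a) /\
  if s.1 22 < s.1 7 then
    s'.1 7 = s.1 22 /\ flags n s'.2 b_best = flags n s.2 b_sel
  else s'.1 7 = s.1 7 /\ flags n s'.2 b_best = flags n s.2 b_best.
Proof.
move=> L; rewrite /keep_best run_Seq; set s1 := run (Block _) s.
have L1 : laid_out n s1 by apply: laid_out_run L.
have [r14 r7 r22 E1] : [/\ s1.1 14 = s.1 7 - s.1 22, s1.1 7 = s.1 7,
    s1.1 22 = s.1 22 & s1.2 = s.2].
  by rewrite /s1 ?run_Block /effects /=; case: (s).
clearbody s1; rewrite run_When r14 subn_eq0 ltnNge; case: leqP => _ /=.
  by rewrite r7 E1.
rewrite run_Seq; set s2 := run (Block _) s1.
have L2 : laid_out n s2 by apply: laid_out_run L1.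
have [r7_2 E2] : s2.1 7 = s.1 22 /\ s2.2 = s.2.
  rewrite /s2 ?run_Block /effects /=; have := L1 23 isT.
  by case: (s1) r22 E1 => r m /= -> -> ->; rewrite addn0.
clearbody s2; have E3 := run_copy L2 (erefl : 5 \notin writes (copy 5 6)) 
  (erefl : 6 \notin writes (copy 5 6)).
rewrite (L2 5) // (L2 6) //= in E3.
split=> [a lt_a|].
  by rewrite E3 ?E2; [case: ifP => [|_] //; rewrite -/b_cov; lia|right].
split; first by rewrite run_frame.
apply/setP => i; have := ltn_ord i; rewrite !inE E3 => [lt_i|]; last by right.
by rewrite -!/b_cov leq_addr ltn_add2l lt_i /= addKn E2.
Qed.

Lemma run_greedy_for_all s : laid_out n s -> s.1 7 = n -> holds_matrix s.2 -> 0 < n ->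
  let s' := run greedy_for_all s in
  [/\ exists v : 'I_n, greedy v (separated v) (flags n s'.2 b_best) [set v],
      forall v : 'I_n, exists2 S, greedy v (separated v) S [set v]
        & #|flags n s'.2 b_best| <= #|S|,
      s'.1 7 = #|flags n s'.2 b_best| & holds_matrix s'.2].
Proof.
move=> L r7 M n_gt0.
(* Before the first run the array of the best selection is meaningless; the initial value n of
   register 7 marks this case. *)
pose I k (s' : store) := [/\ holds_matrix s'.2, s'.1 7 < n -> exists2 v : 'I_n,
    greedy v (separated v) (flags n s'.2 b_best) [set v]
    & s'.1 7 = #|flags n s'.2 b_best|
  & forall v : 'I_n, v < k -> exists2 S, greedy v (separated v) S [set v]
    & s'.1 7 <= #|S|].
have := @forP I 8 9 (Seq greedy_for_node keep_best) s isT.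
rewrite (L 0) //= => -[].
- by move=> k r r' m F; rewrite /I /= !F.
- by split; rewrite // r7 ltnn.
- move=> k s1 lt_k F r8 _ [M1 best1 all1]; rewrite run_Seq.
  have L1 : laid_out n s1 by apply: laid_out_frame F L.
  have [Em gr r22] := run_greedy_for_node (v := Ordinal lt_k) L1 r8 M1.
  set s2 := run greedy_for_node s1 in Em gr r22 *.
  have L2 : laid_out n s2 by apply: laid_out_run L1.
  have r7_2 : s2.1 7 = s1.1 7 by rewrite run_frame.
  have best2 : flags n s2.2 b_best = flags n s1.2 b_best.
    by apply: flags_eq => i; rewrite Em // leq_addr orbT.
  have M2 : holds_matrix s2.2 by apply: holds_matrix_eq M1 => a lt_a; rewrite Em ?lt_a.
  clearbody s2; have [Em' best'] := run_keep_best L2.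
  split.
  + by apply: holds_matrix_eq M2 => a lt_a; rewrite Em' //; lia.
  + case: ifP best' => _ [-> ->] lt_n.
      by exists (Ordinal lt_k).
    by rewrite best2 r7_2 in lt_n *; exact: best1.
  move=> v; rewrite ltnS leq_eqVlt => /predU1P[vk|/all1[S grS le_S]].
    have -> : v = Ordinal lt_k by apply: val_inj.
    exists (flags n s2.2 b_sel) => //; rewrite -r22.
    by case: ltnP best' => le_r [-> _].
  exists S => //; apply: leq_trans le_S.
  by case: ltnP best' => le_r [-> _]; rewrite -r7_2 // ltnW.
move=> [M' best' all'] _; set s' := run _ s in M' best' all' *.
(* A selection for [v] omits [v], so it has fewer than n nodes and the first run already beats the
   initial value. *)
have r7' : s'.1 7 < n.
  have [S gr le_S] := all' (Ordinal n_gt0) n_gt0; apply: leq_ltn_trans le_S _.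
  have [vS _] := greedy_resolves gr.
  rewrite -[n in _ < n]card_ord -cardsT proper_card // properE subsetT.
  by apply/subsetPn; exists (Ordinal n_gt0).
have [v gr r7E] := best' r7'; split=> //; first by exists v.
by move=> w; rewrite -r7E; apply: all'.
Qed.

End RamGreedy.

(** * Metric representations and feasible sets *)

Lemma bigminn_le (I : finType) (P : pred I) (F : I -> nat) x j :
  P j -> \big[minn/x]_(i | P i) F i <= F j.
Proof.
move=> Pj; have : j \in index_enum I by exact: mem_index_enum.
elim: (index_enum I) => // i r IH; rewrite inE big_cons => /predU1P[<-|jr].
  by rewrite Pj geq_minl.
by case: ifP => _; [apply: leq_trans (geq_minr _ _) (IH jr)|exact: IH].
Qed.

Section Distance.

Variables (T : finType) (e : rel T).

Lemma dist_le u v p : path e u p -> last u p = v -> dist e u v <= size p.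
Proof.
move=> /shortenP[q path_q uniq_q sub_q] last_q.
have le_qp : size q <= size p.
  by apply: uniq_leq_size sub_q; case/andP: uniq_q.
apply: leq_trans le_qp; rewrite leqNgt; apply/negP => /(before_find 0).
have lt_q : size q < #|T|.
  by have := card_uniqP uniq_q => /= <-; apply: max_card.
rewrite nth_iota // add0n => /negbT/negP; apply.
rewrite /has_path; apply/existsP; exists (in_tuple q).
by rewrite path_q uniq_q /= last_q.
Qed.

Hypotheses (e_simple : simple_graph e) (e_conn : connected_graph e).

Let e_sym : symmetric e. Proof. by case: e_simple. Qed.
Let e_irr : irreflexive e. Proof. by case: e_simple. Qed.

Lemma dist_path u v :
  exists p, [/\ path e u p, uniq (u :: p), last u p = v & size p = dist e u v].
Proof.
have /connectP[p path_p last_p] := e_conn u v.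
case/shortenP: path_p last_p => q path_q uniq_q _ last_q.
have lt_q : size q < #|T|.
  by have := card_uniqP uniq_q => /= <-; apply: max_card.
have hasq : has (fun k => has_path e k u v) (iota 0 #|T|).
  apply/hasP; exists (size q); first by rewrite mem_iota.
  rewrite /has_path; apply/existsP; exists (in_tuple q).
  by rewrite path_q uniq_q -last_q /=.
have := nth_find 0 hasq.
rewrite nth_iota; last by rewrite -[X in _ < X](size_iota 0) -has_find.
rewrite add0n -/(dist e u v) => /existsP[t /and3P[path_t uniq_t /eqP last_t]].
by exists t; rewrite size_tuple.
Qed.

Lemma dist_refl u : dist e u u = 0.
Proof. by apply/eqP; rewrite -leqn0 (@dist_le u u [::]). Qed.

Lemma dist_gt0 u v : u != v -> 0 < dist e u v.
Proof.
by have [[|x p] [_ _ <- <-]] := dist_path u v; rewrite //= eqxx.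
Qed.

Lemma dist_eq0 u v : (dist e u v == 0) = (u == v).
Proof.
have [->|uv] := eqVneq u v; first by rewrite dist_refl.
by apply/negbTE; rewrite -lt0n dist_gt0.
Qed.

Lemma dist_triangle u w v : dist e u v <= dist e u w + dist e w v.
Proof.
have [p [path_p _ last_p <-]] := dist_path u w.
have [q [path_q _ last_q <-]] := dist_path w v.
by rewrite -size_cat; apply: dist_le; rewrite ?cat_path ?last_cat last_p ?path_p.
Qed.

Lemma dist_sym u v : dist e u v = dist e v u.
Proof.
suff le u' v' : dist e u' v' <= dist e v' u' by apply/eqP; rewrite eqn_leq !le.
have [p [path_p _ last_p <-]] := dist_path v' u'.
have -> : size p = size (rev (belast v' p)) by rewrite size_rev size_belast.
apply: dist_le.
  rewrite -last_p rev_path; under eq_path do rewrite e_sym; exact: path_p.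
by rewrite -last_p; case: (p) => //= x q; rewrite rev_cons last_rcons.
Qed.

Lemma dist_eq1 u v : (dist e u v == 1) = e u v.
Proof.
apply/eqP/idP => [E|uv].
  have [[|x [|y p]] []] := dist_path u v; rewrite E //=.
  by rewrite andbT => ux _ <-.
apply/eqP; rewrite eqn_leq (@dist_le u v [:: v]) /= ?uv // dist_gt0 //.
by apply: contraTneq uv => ->; rewrite e_irr.
Qed.

Definition separated_nodes (v w : T) : {set T} := [set u | dist e w u != dist e w v].

(** The minimum is 1 exactly if some [v] is alone in its class. Nodes of [V] belong to no class, but
    each separates itself from [v], so all nodes other than [v] may be treated alike. Since there is
    a second node, resolving [v] also forces [V] to be nonempty. *)
Lemma feasible_resolves V : 1 < #|T| ->
  reflect (exists v, resolves v (separated_nodes v) V) (feasible e V).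
Proof.
move=> T_gt1.
have rep_eq v u : (metric_rep e V v == metric_rep e V u) =
    [forall w in V, dist e w u == dist e w v].
  apply/eqP/forall_inP => [E w wV|E].
    have := congr1 (nth 0 ^~ (index w (enum V))) E.
    rewrite !(nth_map w) ?index_mem ?mem_enum // nth_index ?mem_enum //.
    by rewrite ![dist e w _]dist_sym => ->.
  apply/eq_in_map => w; rewrite mem_enum => /E/eqP.
  by rewrite ![dist e w _]dist_sym => ->.
have eqv : {in ~: V & &,
    equivalence_rel [rel x y | metric_rep e V x == metric_rep e V y]}.
  by move=> x y z _ _ _ /=; split=> // /eqP->.
pose P := metric_classes e V.
have partP : partition P (~: V) by apply: preim_partitionP.
have class_gt0 C : C \in P -> 0 < #|C|.
  move=> CP; rewrite card_gt0; case/and3P: (partP) => _ _; apply: contraNneq => <-.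
  exact: CP.
(* As [#|T|] exceeds 1, the value 1 cannot be the neutral one and must be the size of a class. *)
have mu1 : (mu e V == 1) = [exists C in P, #|C| == 1].
  apply/eqP/exists_inP => [|[C CP /eqP C1]].
    rewrite /mu; elim/big_ind: _ => [E|x y IHx IHy|C CP C1].
    - by rewrite E in T_gt1.
    - by rewrite /minn; case: ifP.
    - by exists C; rewrite ?C1.
  apply/eqP; rewrite eqn_leq; apply/andP; split.
    by rewrite -[X in _ <= X]C1 /mu; apply: (bigminn_le (fun C : {set T} => #|C|)).
  rewrite /mu; elim/big_ind: _ => [|x y x0 y0|C' C'P]; first exact: ltnW.
    by rewrite leq_min x0.
  exact: class_gt0.
apply: (iffP idP) => [|[v [vV Vres]]].
  case/and3P=> _ _; rewrite mu1 => /exists_inP[C CP /cards1P[v EC]].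
  have vC : v \in C by rewrite EC set11.
  have vV : v \in ~: V.
    by case/and3P: (partP) => /eqP <- _ _; apply/bigcupP; exists C.
  exists v; split=> [|u uv]; first by rewrite inE in vV.
  have [uV|uV] := boolP (u \in V).
    exists u; rewrite // inE dist_refl eq_sym dist_eq0 //.
  apply/exists_inP; rewrite -[X in is_true X]negbK; apply: contraNN uv.
  rewrite negb_exists => /forallP nsep.
  have : u \in C.
    have <- : pblock P v = C.
      by case/and3P: (partP) => _ tP _; apply: def_pblock tP CP vC.
    rewrite pblock_equivalence_partition // ?inE //= ?rep_eq.
    apply/forall_inP => w wV; have := nsep w; rewrite wV inE negbK //.
  by rewrite EC inE.
have vVC : v \in ~: V by rewrite inE.
have [u uv] : exists u, u != v.
  have : 0 < #|~: [set v]| by rewrite cardsC1; lia.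
  by rewrite card_gt0 => /set0Pn[u]; rewrite !inE; exists u.
have [w wV _] := Vres u uv.
apply/and3P; split.
- by rewrite properE sub0set /=; apply/subsetPn; exists w; rewrite ?inE.
- by rewrite properE subsetT /=; apply/subsetPn; exists v; rewrite ?inE.
rewrite mu1; apply/exists_inP; exists (pblock P v).
  by apply: pblock_mem; case/and3P: (partP) => /eqP->.
apply/cards1P; exists v; apply/setP => x; rewrite inE.
have [->|xv] := eqVneq x v; first by rewrite mem_pblock; case/and3P: (partP) => /eqP->.
apply/negbTE/negP => xC.
have xVC : x \in ~: V.
  case/and3P: (partP) => /eqP <- _ _; apply/bigcupP; exists (pblock P v) => //.
  by apply: pblock_mem; case/and3P: (partP) => /eqP->.
move: xC; rewrite pblock_equivalence_partition //= rep_eq => /forall_inP E.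
by have [w' w'V] := Vres x xv; rewrite inE (E w' w'V).
Qed.

Lemma feasible_setC1 v : 1 < #|T| -> feasible e (~: [set v]).
Proof.
move=> T_gt1; apply/(feasible_resolves _ T_gt1); exists v.
split=> [|u uv]; first by rewrite !inE eqxx.
by exists u; rewrite !inE // dist_refl eq_sym dist_eq0.
Qed.

Lemma Lopt_le V : feasible e V -> Lopt e <= #|V|.
Proof. exact: (bigminn_le (fun V : {set T} => #|V|)). Qed.

Lemma Lopt_attained : 1 < #|T| -> exists2 V, feasible e V & #|V| = Lopt e.
Proof.
move=> T_gt1; have [v _] : exists v : T, true.
  by have /card_gt0P[v _] := ltnW T_gt1; exists v.
(* The neutral value is ruled out by the complement of a single node, a feasible set with one node
   less. *)
suff : Lopt e = #|T| \/ exists2 V, feasible e V & #|V| = Lopt e.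
  case=> // E; have := Lopt_le (feasible_setC1 v T_gt1).
  by rewrite E cardsC1; lia.
rewrite /Lopt; elim/big_ind: _ => [|x y IHx IHy|V fV]; first by left.
  by rewrite /minn; case: ifP.
by right; exists V.
Qed.

Lemma feasible_gt0 V : feasible e V -> 0 < #|V|.
Proof. by case/and3P=> /proper_card; rewrite cards0. Qed.

Lemma Lopt_gt0 : 1 < #|T| -> 0 < Lopt e.
Proof. by move=> /Lopt_attained[V /feasible_gt0 V0 <-]. Qed.

Lemma Lopt_degree1 v : 1 < #|T| -> degree e v = 1 -> Lopt e = 1.
Proof.
move=> T_gt1 /eqP/cards1P[w Ew]; apply/eqP; rewrite eqn_leq Lopt_gt0 // andbT.
rewrite -(cards1 v); apply: Lopt_le; apply/(feasible_resolves _ T_gt1); exists w.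
have vw : e v w by have := set11 w; rewrite -Ew inE.
split=> [|u uw].
  by rewrite inE; apply: contraTneq vw => ->; rewrite e_irr.
exists v; rewrite inE // (eqP (_ : dist e v w == 1)) ?dist_eq1 //.
by apply: contraNN uw => vu; rewrite -in_set1 -Ew inE.
Qed.

Lemma degree_gt0 v : 1 < #|T| -> 0 < degree e v.
Proof.
move=> T_gt1; have [u uv] : exists u, u != v.
  have : 0 < #|~: [set v]| by rewrite cardsC1; lia.
  by rewrite card_gt0 => /set0Pn[u]; rewrite !inE; exists u.
have [[|x p] []] := dist_path v u; first by move=> _ _ vu; rewrite -vu eqxx in uv.
by move=> /andP[vx _] _ _ _; rewrite card_gt0; apply/set0Pn; exists x; rewrite inE.
Qed.

(* A second node adjacent to both neighbours would close a 4-cycle. *)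
Lemma feasible_neighbours v (V : {set T}) : 1 < #|T| -> ~ contains_C4 e ->
  V \subset [set u | e v u] -> #|V| = 2 -> feasible e V.
Proof.
move=> T_gt1 noC4 /subsetP sub /eqP/cards2P[x [y [xy EV]]].
apply/(feasible_resolves _ T_gt1); exists v.
have vV w : w \in V -> e v w by move=> /sub; rewrite inE.
have vx : e v x by apply: vV; rewrite EV !inE eqxx.
have vy : e v y by apply: vV; rewrite EV !inE eqxx orbT.
split=> [|u uv]; first by apply/negP => /vV; rewrite e_irr.
have [ux|ux] := boolP (e u x); last first.
  exists x; rewrite ?inE ?EV ?inE ?eqxx // ![dist e x _]dist_sym.
  by rewrite (eqP (_ : dist e v x == 1)) ?dist_eq1.
have [uy|uy] := boolP (e u y); last first.
  exists y; rewrite ?inE ?EV ?inE ?eqxx ?orbT // ![dist e y _]dist_sym.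
  by rewrite (eqP (_ : dist e v y == 1)) ?dist_eq1.
case: noC4; exists [tuple v; x; u; y] => /=.
rewrite vx e_sym ux uy e_sym vy /= !inE !negb_or (eq_sym v u) uv xy.
have neq a b : e a b -> a != b by apply: contraTneq => ->; rewrite e_irr.
by rewrite !neq // e_sym.
Qed.

Lemma degree_cases v : 1 < #|T| -> Lopt e != 1 -> 1 < degree e v.
Proof.
move=> T_gt1 L1; rewrite ltn_neqAle degree_gt0 // andbT eq_sym.
by apply: contra L1 => /eqP/Lopt_degree1->.
Qed.

Lemma Lopt_C4_free : 1 < #|T| -> ~ contains_C4 e -> Lopt e <= 2.
Proof.
move=> T_gt1 noC4; have /card_gt0P[v _] := ltnW T_gt1.
have [->//|/(degree_cases v T_gt1)] := eqVneq (Lopt e) 1.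
case/card_gt1P=> x [y [xv yv xy]].
have E : #|[set x; y]| = 2 by rewrite cards2 xy.
rewrite -E; apply/Lopt_le/(@feasible_neighbours v) => //.
by apply/subsetP => u; move: xv yv; rewrite !inE => xv yv /orP[]/eqP->.
Qed.

End Distance.

(** * The programs *)

(* Register 15 counts down from 2 as neighbours of node 0 are found; they
   replace a best selection of more than one node. *)
Definition pick_neighbour :=
  Seq (Block [:: Add 14 10 2; Fetch 14 14; Sub 17 14 2; Sub 14 2 14;
                 Add 14 14 17; Sub 14 2 14; Const 16 0])
  (Seq (When 14 (When 15 (Block [:: Const 16 1; Sub 15 15 2])))
       (Block [:: Add 14 6 10; Store 14 16])).

Definition pick_neighbours :=
  Seq (Block [:: Sub 14 7 2])
      (When 14 (Seq (Block [:: Const 15 2]) (For 10 11 pick_neighbour))).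

(** The outer Floyd-Warshall loop leaves n * n + 1 in register 9, the base address of the arrays.
    Register 7 starts with n, more than any selection can have. *)
Definition all_distances :=
  Seq (Block [:: Const 2 1]) (Seq init_distances (Seq floyd_warshall
    (Block [:: Add 3 9 23; Add 4 3 0; Add 5 4 0; Add 6 5 0; Add 7 0 23]))).

(** Register 23 holds 0, so the final [copy] moves the best flags to the output cells. It overwrites
    n and part of the matrix and thus has to come last. *)
Definition separation_program (c : cmd) :=
  Seq all_distances (Seq greedy_for_all (Seq c (copy 6 23))).

(** * Correctness of the choice of two neighbours *)

Section PickNeighbours.

Variables (n : nat) (d : nat -> nat -> nat).

Let b_best := n * n + 1 + n + n + n.

Definition row0 : {set 'I_n} := [set i : 'I_n | d 0 i == 1].

Lemma run_pick_neighbours s : laid_out n s -> holds_matrix n d s.2 -> 0 < n ->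
  let s' := run pick_neighbours s in
  if 1 < s.1 7 then
    1 < #|row0| -> flags n s'.2 b_best \subset row0 /\ #|flags n s'.2 b_best| = 2
  else s'.2 = s.2.
Proof.
move=> L M n_gt0; rewrite /pick_neighbours run_Seq; set s1 := run (Block _) s.
have L1 : laid_out n s1 by apply: laid_out_run L.
have [r14 E1] : s1.1 14 = s.1 7 - 1 /\ s1.2 = s.2.
  by rewrite /s1 ?run_Block /effects /=; have := L 2 isT; case: (s) => r m /= ->.
clearbody s1; rewrite run_When r14 subn_eq0 [1 < _]ltnNge; case: (_ <= 1) => //= row0_gt1.
rewrite run_Seq; set s2 := run (Block _) s1.
have L2 : laid_out n s2 by apply: laid_out_run L1.
have [r15 E2] : s2.1 15 = 2 /\ s2.2 = s.2.
  by rewrite /s2 ?run_Block /effects /= -E1; case: (s1).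
clearbody s2.
(* From index [k] on, the array still contains the old selection, hence the restriction to smaller
   indices. *)
pose A k m := [set i in flags n m b_best | i < k].
pose N k := [set i in row0 | i < k].
pose I k (s' : store) := [/\ forall a, a < b_best -> s'.2 a = s.2 a,
  A k s'.2 \subset N k, #|A k s'.2| + s'.1 15 = 2 & 0 < s'.1 15 -> A k s'.2 = N k].
have full (B : {set 'I_n}) : [set i in B | i < n] = B.
  by apply/setP => i; rewrite inE ltn_ord andbT.
have none (B : {set 'I_n}) : [set i in B | i < 0] = set0.
  by apply/setP => i; rewrite !inE andbF.
have [] := @forP I 10 11 pick_neighbour s2 isT; last first.
- rewrite (L2 0) //= => -[_]; rewrite /A /N !full => sub card_A eqN _; split=> //.
  (* If register 15 were still positive, all nodes of [row0] would be flagged; being at least two,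
     they would push the sum above 2. *)
  case: posnP eqN card_A => [-> _|r_gt0 /(_ isT) -> E]; first by rewrite addn0.
  by have := leq_add row0_gt1 r_gt0; rewrite E.
- move=> k s3; rewrite (L2 0) //= => lt_k F r10 _ [Em sub card_A eqN].
  have r2 : s3.1 2 = 1 by rewrite F // L2.
  have r6 : s3.1 6 = b_best by rewrite F // L2.
  have dk : s3.2 (k + 1) = d 0 k.
    by rewrite -(M 0 k) // /cell mul0n add0n addnC Em // /b_best; nia.
  case: s3 r10 r2 r6 dk Em sub card_A eqN {F} => r m /= r10 r2 r6 dk Em sub card_A eqN.
  pose K := Ordinal lt_k.
  have upd_A m' : m' (b_best + k) != 0 ->
    (forall i : 'I_n, i < k -> m' (b_best + i) = m (b_best + i)) ->
    A k.+1 m' = K |: A k m.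
    move=> mk' E'; apply/setP => i; rewrite !inE ltnS leq_eqVlt -val_eqE /=.
    case: (eqVneq (val i) k) => [->|_] //=; first by rewrite mk'.
    by case: ltnP => [/E'->|]; rewrite ?andbF.
  have upd_A0 m' : m' (b_best + k) = 0 ->
    (forall i : 'I_n, i < k -> m' (b_best + i) = m (b_best + i)) ->
    A k.+1 m' = A k m.
    move=> mk' E'; apply/setP => i; rewrite !inE ltnS leq_eqVlt.
    case: (eqVneq (val i) k) => [->|_] /=; first by rewrite mk' ltnn andbF.
    by case: ltnP => [/E'->|]; rewrite ?andbF.
  have upd_N : N k.+1 = if d 0 k == 1 then K |: N k else N k.
    apply/setP => i; rewrite !inE ltnS leq_eqVlt.
    case: ifP => dk1; rewrite !inE -?val_eqE /=; case: (eqVneq (val i) k) => [->|_] //=.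
    by rewrite dk1.
    by rewrite dk1.
  have KA m' : K \notin A k m' by rewrite !inE ltnn andbF.
  rewrite /pick_neighbour 2!run_Seq.
  rewrite ?run_Block /effects /= ?run_When /= ?run_When /= ?run_Block /effects /=.
  rewrite r10 r2 dk.
  (* Subtracting the absolute difference of the distance and 1 from 1 tests whether the distance is
     1. *)
  have -> : (1 - (1 - d 0 k + (d 0 k - 1)) == 0) = (d 0 k != 1) by lia.
  have out m' x : (forall a, m' a = if a == b_best + k then x else m a) ->
      (forall a, a < b_best -> m' a = s.2 a) /\
      forall i : 'I_n, i < k -> m' (b_best + i) = m (b_best + i).
    move=> E'; split=> [a lt_a|i lt_i]; rewrite E' ?eqn_add2l.
      by rewrite (ltn_eqF (leq_trans lt_a (leq_addr _ _))) Em.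
    by rewrite ltn_eqF.
  case: eqVneq upd_N => [dk1|_] upd_N /=; last first.
    rewrite r6 r10; have [Em' old] := out (upd m (b_best + k) 0) 0 (fun=> erefl).
    by rewrite /I /= upd_N upd_A0 //= eqxx.
  case: eqP => [r15_0|r15_gt0] /=; rewrite r6 r10.
    have [Em' old] := out (upd m (b_best + k) 0) 0 (fun=> erefl).
    rewrite /I /= upd_N upd_A0 //= ?eqxx //; split=> //; last by rewrite r15_0.
    exact: subset_trans sub (subsetUr _ _).
  have [Em' old] := out (upd m (b_best + k) 1) 1 (fun=> erefl).
  have r15' : 0 < r 15 by rewrite lt0n; apply/eqP.
  rewrite /I /= upd_N upd_A //= ?eqxx // eqN //; split=> //.
  rewrite cardsU1 -eqN // KA; by rewrite [_ + #|_|]addnC -addnA subnKC.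
- split; rewrite ?E2 //= /A /N !none ?cards0 ?r15 //.
- by move=> k r r' m F; rewrite /I /= !F.
Qed.

End PickNeighbours.

(** * From matrix indices back to nodes, and the results of the programs *)

Section Graph.

Variables (T : finType) (e : rel T) (x0 : T).
Hypotheses (e_simple : simple_graph e) (e_conn : connected_graph e).
Hypothesis T_gt1 : 1 < #|T|.

Let n := #|T|.

Definition node (i : nat) : T := nth x0 (enum T) i.

Definition node_dist (i j : nat) : nat := dist e (node i) (node j).

Lemma node_rank x : node (enum_rank x) = x.
Proof. by rewrite /node -enum_val_nth enum_rankK. Qed.

Lemma node_inj i j : i < n -> j < n -> node i = node j -> i = j.
Proof.
move=> lt_i lt_j /eqP; rewrite nth_uniq ?enum_uniq -?cardT //.
by move/eqP.
Qed.

Lemma nth_allpairs (A B C : Type) (f : A -> B -> C) a b c s t i j :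
  i < size s -> j < size t ->
  nth c [seq f x y | x <- s, y <- t] (i * size t + j) = f (nth a s i) (nth b t j).
Proof.
move=> + lt_j; elim: s i => // x s IH [|i] /= lt_i.
  by rewrite nth_cat size_map lt_j (nth_map b).
rewrite nth_cat size_map mulSn -addnA ltnNge leq_addr /= addKn.
exact: IH.
Qed.

Lemma memory_input i j : i < n -> j < n ->
  memory (input e) (cell n i j) = e (node i) (node j).
Proof.
move=> lt_i lt_j; rewrite /cell addnAC addn1 /= /n {1}cardT.
by rewrite (nth_allpairs _ x0 x0) // -cardT.
Qed.

Lemma node_path i j : i < n -> j < n -> i != j ->
  exists q, [/\ path (fun i j => e (node i) (node j)) i (rcons q j), uniq q,
    all (gtn n) q & node_dist i j = (size q).+1].
Proof.
move=> lt_i lt_j ij; have [p] := dist_path e_conn (node i) (node j).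
case/lastP: p => [|p y] [path_p uniq_p last_p size_p].
  by case/eqP: ij; apply: node_inj.
move: last_p; rewrite last_rcons => yj; subst y.
pose rank (x : T) := nat_of_ord (enum_rank x).
have rank_node k : k < n -> rank (node k) = k.
  by move=> lt_k; apply: node_inj; rewrite ?node_rank ?ltn_ord.
exists (map rank p); split.
- rewrite -{1}(rank_node i lt_i) -(rank_node j lt_j) -map_rcons path_map.
  by rewrite (eq_path (e' := e)) // => x y /=; rewrite !node_rank.
- rewrite map_inj_uniq; last by move=> x y /val_inj/enum_rank_inj.
  by move: uniq_p; rewrite /= rcons_uniq => /and3P[].
- by apply/allP => _ /mapP[x _ ->] /=; apply: ltn_ord.
- by rewrite /node_dist -size_p size_rcons size_map.
Qed.

Let s0 : store := (upd (fun=> 0) 0 n, memory (input e)).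

Lemma run_all_distances : let s := run all_distances s0 in
  [/\ laid_out n s, s.1 7 = n & holds_matrix n node_dist s.2].
Proof.
rewrite /all_distances 3!run_Seq; set s1 := run (Block _) s0.
have [r0 r2 r23 E1] : [/\ s1.1 0 = n, s1.1 2 = 1, s1.1 23 = 0
  & s1.2 = memory (input e)] by [].
clearbody s1; set s2 := run init_distances s1.
have E2 := run_init_distances r0 r2; rewrite -/s2 E1 in E2.
have [r0_2 r2_2 r23_2] : [/\ s2.1 0 = n, s2.1 2 = 1 & s2.1 23 = 0].
  by split; rewrite run_frame.
clearbody s2; set s3 := run floyd_warshall s2.
have [r0_3 r2_3 r23_3] : [/\ s3.1 0 = n, s3.1 2 = 1 & s3.1 23 = 0].
  by split; rewrite run_frame.
have r9 : s3.1 9 = n * n + 1.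
  by have [] := @forP (fun _ _ => True) 8 9 (For 10 11 (For 12 13 relax_cell)) s2 isT;
    rewrite // r0_2.
have M3 : holds_matrix n node_dist s3.2.
  have [e_sym e_irr] := e_simple.
  apply: (@run_floyd_warshall n (fun i j => e (node i) (node j))) => //.
  - by move=> i j k _ _ _; apply: dist_triangle.
  - exact: node_path.
  - move=> i j lt_i lt_j; rewrite E2 // memory_input // /node_dist.
    have [<-|ij] := eqVneq i j; first by rewrite dist_refl.
    rewrite andbT; case eij: (e _ _) => /=.
      by rewrite (eqP (_ : dist e (node i) (node j) == 1)) ?dist_eq1.
    (* The entry n is an upper bound by the definition of [dist], a search in a list of n
       lengths. *)
    by rewrite -[X in _ <= X](size_iota 0) find_size.
  - by move=> i lt_i; rewrite E2 // memory_input // e_irr eqxx.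
  - by move=> i j lt_i lt_j eij; rewrite E2 // memory_input // eij.
clearbody s3; rewrite ?run_Block /effects /=.
case: s3 r0_3 r2_3 r23_3 r9 M3 => r m /= r0_3 r2_3 r23_3 r9 M3.
rewrite r0_3 r23_3 r9 !addn0; split=> // x.
rewrite !inE => /or4P[/eqP->|/eqP->|/eqP->|/or4P[/eqP->|/eqP->|/eqP->|/eqP->]] //=.
Qed.

Definition to_nodes (F : {set 'I_n}) : {set T} := enum_rank @^-1: F.

Lemma card_to_nodes F : #|to_nodes F| = #|F|.
Proof.
by apply: on_card_preimset; exists enum_val => x _; rewrite ?enum_rankK ?enum_valK.
Qed.

Definition of_nodes (V : {set T}) : {set 'I_n} := [set i | enum_val i \in V].

Lemma of_nodesK V : to_nodes (of_nodes V) = V.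
Proof. by apply/setP => x; rewrite !inE enum_rankK. Qed.

Lemma card_of_nodes V : #|of_nodes V| = #|V|.
Proof. by rewrite -card_to_nodes of_nodesK. Qed.

Lemma mem_separated_nodes (v w u : T) :
  (u \in separated_nodes e v w) =
  (enum_rank u \in separated node_dist (enum_rank v) (enum_rank w)).
Proof. by rewrite !inE /node_dist !node_rank. Qed.

Lemma resolves_to_nodes (v : T) (F : {set 'I_n}) :
  resolves v (separated_nodes e v) (to_nodes F) <->
  resolves (enum_rank v) (separated node_dist (enum_rank v)) F.
Proof.
split=> -[vF res]; split; rewrite ?inE // in vF *.
  move=> u uv; have [|w] := res (enum_val u).
    by apply: contra uv => /eqP <-; rewrite enum_valK.
  by rewrite inE mem_separated_nodes enum_valK; exists (enum_rank w).
move=> u uv; have [|w wF] := res (enum_rank u).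
  by apply: contra uv => /eqP/enum_rank_inj->.
exists (enum_val w); first by rewrite inE enum_valK.
by rewrite mem_separated_nodes enum_valK.
Qed.

Definition best_flags (m : nat -> nat) : {set 'I_n} :=
  flags n m (n * n + 1 + n + n + n).

Lemma output_copy s : laid_out n s ->
  [set v : T | (run (copy 6 23) s).2 (enum_rank v) != 0] = to_nodes (best_flags s.2).
Proof.
move=> L; have E := run_copy L (erefl : 6 \notin writes (copy 6 23))
  (erefl : 23 \notin writes (copy 6 23)).
apply/setP => v; have := ltn_ord (enum_rank v); rewrite !inE E ?(L 6) ?(L 23) //=.
  by move=> lt_v; rewrite add0n lt_v subn0.
by left; nia.
Qed.

(** A feasible [V] is compared with the greedy run for the very [v] that [V] singles out; that run
    is among the n runs, and the best selection is no larger than its result. *)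
Lemma run_greedy : let s := run greedy_for_all (run all_distances s0) in
  [/\ laid_out n s, holds_matrix n node_dist s.2, s.1 7 = #|best_flags s.2|,
      feasible e (to_nodes (best_flags s.2))
    & forall V, feasible e V -> exists v S, [/\ resolves (enum_rank v)
        (separated node_dist (enum_rank v)) (of_nodes V),
        greedy (enum_rank v) (separated node_dist (enum_rank v)) S [set enum_rank v]
      & #|best_flags s.2| <= #|S|]].
Proof.
have [L r7 M] := run_all_distances.
have d_refl i : i < n -> node_dist i i = 0 by move=> _; apply: dist_refl.
have d_gt0 i j : i < n -> j < n -> i != j -> 0 < node_dist i j.
  move=> lt_i lt_j ij; apply: dist_gt0 => //; apply: contra ij => /eqP/node_inj->//.
have [[v gr] all_v r7' M'] := run_greedy_for_all d_refl d_gt0 L r7 M (ltnW T_gt1).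
split=> //; first exact: laid_out_run L.
  apply/feasible_resolves => //; exists (enum_val v); apply/resolves_to_nodes.
  by rewrite enum_valK; apply: greedy_resolves gr.
move=> V /feasible_resolves[] // w res; have [S gr' le_S] := all_v (enum_rank w).
by exists w, S; split=> //; apply/resolves_to_nodes; rewrite of_nodesK.
Qed.

Let best := best_flags (run greedy_for_all (run all_distances s0)).2.

Lemma best_ratio (R : realType) :
  (#|best|%:R <= (1 + ln (n - 1)%:R) * (Lopt e)%:R :> R)%R.
Proof.
have [_ _ _ _ opt] := run_greedy.
have [V fV cardV] := Lopt_attained e_simple e_conn T_gt1.
have [v [S [res gr le_S]]] := opt V fV.
have := greedy_ratio R (@separatedN _ _ _) gr res.
rewrite cards1 subnn /harmonic_sum big_ord0 mulr0 addr0 card_ord -/(harmonic_sum R _).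
rewrite card_of_nodes cardV.
move=> le_S'; apply: le_trans (_ : #|S|%:R <= _)%R; first by rewrite ler_nat.
apply: le_trans le_S' _; rewrite mulrC ler_wpM2r // harmonic_ln //.
by rewrite subn_gt0.
Qed.

Lemma best_Lopt1 : Lopt e = 1 -> #|best| = 1.
Proof.
move=> L1; have [_ _ _ fbest opt] := run_greedy.
have [V fV cardV] := Lopt_attained e_simple e_conn T_gt1.
have [v [S [res gr le_S]]] := opt V fV.
have /eqP/cards1P[w EV] : #|of_nodes V| = 1 by rewrite card_of_nodes cardV.
rewrite EV in res.
have best_gt0 := feasible_gt0 fbest; rewrite card_to_nodes -/best in best_gt0.
apply/eqP; rewrite eqn_leq best_gt0 andbT.
have d_refl i : i < n -> node_dist i i = 0 by move=> _; apply: dist_refl.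
have d_gt0 i j : i < n -> j < n -> i != j -> 0 < node_dist i j.
  by move=> lt_i lt_j ij; apply: dist_gt0 => //; apply: contra ij => /eqP/node_inj->.
(* The alternative in which nothing was selected would make [v] the only node. *)
case: (greedy_single (@separatedN _ _ _) gr res) => [[_ E]|[<- _] //].
have := congr1 (fun A : {set 'I_n} => #|A|) E.
rewrite cards1 cardsT card_ord => E'.
by have := T_gt1; rewrite ltnNge [X in _ <= X]E' leqnn.
Qed.

Definition separation_result (c : cmd) : {set T} :=
  [set v | (run (separation_program c) s0).2 (enum_rank v) != 0].

Lemma separation_result_greedy : separation_result (Block [::]) = to_nodes best.
Proof. by have [L _ _ _ _] := run_greedy; apply: output_copy L. Qed.

(** A greedy result of one node is optimal because no feasible set is empty. Otherwise [best_Lopt1]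
    excludes the optimum 1, so node 0 is not a leaf, and a feasible pair of its neighbours attains
    the least value left. *)
Lemma separation_result_C4_free : ~ contains_C4 e ->
  feasible e (separation_result pick_neighbours) /\
  #|separation_result pick_neighbours| = Lopt e.
Proof.
move=> noC4; have [L M r7 fbest _] := run_greedy.
have -> : separation_result pick_neighbours =
    to_nodes (best_flags (run pick_neighbours
      (run greedy_for_all (run all_distances s0))).2).
  exact: (output_copy (@laid_out_run _ pick_neighbours _ isT L)).
set s := run greedy_for_all _ in L M r7 fbest *.
have n_gt0 : 0 < n by apply: ltnW.
have := run_pick_neighbours L M n_gt0; cbv zeta; rewrite r7 -/best.
have Lopt0 := Lopt_gt0 e_simple e_conn T_gt1.
case: ifP => [best_gt1|best_le1 ->]; last first.
  split=> //; apply/eqP; rewrite eqn_leq Lopt_le // andbT card_to_nodes.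
  by apply: leq_trans Lopt0; rewrite leqNgt best_le1.
have Lopt_neq1 : Lopt e != 1.
  by apply: contraTneq best_gt1 => /best_Lopt1->.
have row0E (i : 'I_n) : (i \in row0 n node_dist) = e (node 0) (enum_val i).
  rewrite inE /node_dist dist_eq1 //; congr (e _ _).
  by rewrite /node -enum_val_nth.
have row0_gt1 : 1 < #|row0 n node_dist|.
  have := degree_cases e_simple e_conn (node 0) T_gt1 Lopt_neq1.
  rewrite /degree; congr (_ < _); rewrite -card_to_nodes.
  by apply: eq_card => u; rewrite [LHS]inE [RHS]inE row0E enum_rankK.
case/(_ row0_gt1) => sub card2.
have card2' : #|to_nodes (best_flags (run pick_neighbours s).2)| = 2.
  by rewrite card_to_nodes.
have fS : feasible e (to_nodes (best_flags (run pick_neighbours s).2)).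
  apply: (@feasible_neighbours _ _ e_simple e_conn (node 0)) => //.
  apply/subsetP => u; rewrite !inE => uF.
  by have := subsetP sub (enum_rank u); rewrite row0E enum_rankK inE; apply.
split=> //; apply/eqP; rewrite eqn_leq Lopt_le // andbT card2'.
by rewrite ltn_neqAle eq_sym Lopt_neq1.
Qed.

End Graph.

Theorem theorem3 :
  (* (a) *)
  (exists (P : program) (c : nat), forall (T : finType) (e : rel T),
     simple_graph e -> connected_graph e -> 1 < #|T| ->
     exists S : {set T},
       [/\ computes_within e P (c * #|T| ^ 3) S,
           feasible e S
         & forall R : realType,
             (#|S|%:R <= (1 + ln (#|T| - 1)%:R) * (Lopt e)%:R :> R)%R])
  (* (b) *)
  /\ ((forall (T : finType) (e : rel T),
         simple_graph e -> connected_graph e -> 1 < #|T| ->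
         (exists v : T, degree e v = 1) -> Lopt e = 1)
      /\ exists (P : program) (c : nat), forall (T : finType) (e : rel T),
           simple_graph e -> connected_graph e -> 1 < #|T| ->
           (exists v : T, degree e v = 1) ->
           exists S : {set T},
             [/\ computes_within e P (c * #|T| ^ 3) S,
                 feasible e S
               & #|S| = Lopt e])
  (* (c) *)
  /\ ((forall (T : finType) (e : rel T),
         simple_graph e -> connected_graph e -> 1 < #|T| ->
         ~ contains_C4 e -> Lopt e <= 2)
      /\ exists (P : program) (c : nat), forall (T : finType) (e : rel T),
           simple_graph e -> connected_graph e -> 1 < #|T| ->
           ~ contains_C4 e ->
           exists S : {set T},
             [/\ computes_within e P (c * #|T| ^ 3) S,
                 feasible e S
               & #|S| = Lopt e]).

Proof.
have [ka computes_a] := compile_computes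
  (isT : wf (separation_program (Block [::]))).
have [kc computes_c] := compile_computes
  (isT : wf (separation_program pick_neighbours)).
have node0 (T : finType) : 1 < #|T| -> T.
  by move=> T_gt1; apply: (@enum_val T T (Ordinal (ltnW T_gt1))).
split; last split; [| split | split].
- eexists _, ka => T e e_simple e_conn T_gt1; pose x0 := node0 T T_gt1.
  have := computes_a T e (ltnW T_gt1).
  rewrite -[X in computes_within _ _ _ X]/(separation_result e (Block [::])).
  rewrite (separation_result_greedy x0) // => comp.
  eexists; split; first exact: comp.
    by have [] := run_greedy x0 e_simple e_conn T_gt1.
  by move=> R; rewrite card_to_nodes; apply: best_ratio x0 _ _ _ _.
- by move=> T e e_simple e_conn T_gt1 [v]; apply: Lopt_degree1.
(* The program of (a) serves again: it finds a single node whenever one suffices. *)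
- eexists _, ka => T e e_simple e_conn T_gt1 [v deg_v]; pose x0 := node0 T T_gt1.
  have := computes_a T e (ltnW T_gt1).
  rewrite -[X in computes_within _ _ _ X]/(separation_result e (Block [::])).
  rewrite (separation_result_greedy x0) // => comp.
  eexists; split; first exact: comp.
    by have [] := run_greedy x0 e_simple e_conn T_gt1.
  have L1 := Lopt_degree1 e_simple e_conn T_gt1 deg_v.
  by rewrite card_to_nodes L1; apply: best_Lopt1 x0 _ _ _ _.
- by move=> T e e_simple e_conn T_gt1; apply: Lopt_C4_free.
- eexists _, kc => T e e_simple e_conn T_gt1 noC4; pose x0 := node0 T T_gt1.
  have comp := computes_c T e (ltnW T_gt1).
  have [fS cardS] := separation_result_C4_free x0 e_simple e_conn T_gt1 noC4.
  by eexists; split; [exact: comp| |].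
Qed.
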